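(* Let $X$ be a pseudocompact Tychonoff space with precaliber $\omega_1$ (e.g., such that $\beta X$ is separable), and let $Y\subset P(\beta X)$ be a pseudocompact subspace containing $P_f(X)$. Then $Y$ is $C^*$-embedded in $P(\beta X)$ (i.e., $\beta Y=P(\beta X)$).
   Context: All spaces are Tychonoff; $\beta X$ is the Stone–Čech compactification of $X$. For a space $Z$, $P(Z)$ is the set of Radon probability measures on the Borel $\sigma$-algebra of $Z$, with the weak topology, i.e. the topology generated by the functions $\mu\mapsto\int_Z f\,d\mu$ for bounded continuous $f:Z\to\mathbb R$. $P_f(X)\subset P(\beta X)$ is the set of probability measures with finite support contained in $X$, i.e. finite convex combinations of Dirac measures $\delta_x$, $x\in X$. A space is pseudocompact if every continuous real-valued function on it is bounded. A space $X$ has precaliber $\omega_1$ if every uncountable family of open subsets of $X$ has an uncountable subfamily with the finite intersection property (every nonempty finite subfamily has nonempty intersection). A subspace $Y\subset Z$ is $C^*$-embedded in $Z$ if every bounded continuous function $Y\to\mathbb R$ extends to a continuous function on $Z$. *)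

(* Defs.v *)
From HB Require Import structures.
From mathcomp Require Import all_boot all_order all_algebra.
From mathcomp Require Import all_classical all_reals all_analysis.

Set Implicit Arguments.
Unset Strict Implicit.
Unset Printing Implicit Defensive.

Import Order.TTheory GRing.Theory Num.Theory.
Import numFieldNormedType.Exports.

Local Open Scope classical_set_scope.
Local Open Scope ring_scope.

Definition tychonoff_space (X : topologicalType) :=
  hausdorff_space X /\ completely_regular_space X.

Definition pseudocompact (R : realType) (X : topologicalType) :=
  forall f : X -> R, continuous f -> bounded_fun f.

(* [finI] also ranges over the empty subfamily, whose intersection is [setT];
   this adds nothing, since [X] is nonempty when [V] is uncountable. *)
Definition precaliber_omega1 (X : topologicalType) :=
  forall U : set (set X), U `<=` open -> ~ countable U ->
  exists V : set (set X), [/\ V `<=` U, ~ countable V & finI V id].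

Definition cstar_embedded (R : realType) (Z : topologicalType) (Y : set Z) :=
  forall f : Y -> R, continuous f -> bounded_fun f ->
  exists2 g : Z -> R, continuous g & forall y : Y, g (set_val y) = f y.

Definition bcfun (R : realType) (Z : topologicalType) : set (Z -> R) :=
  [set f | continuous f /\ bounded_fun f].
Arguments bcfun : clear implicits.

(* The Stone-Cech compactification of [X] is the closure of the image of [X]
   under the evaluation map into the power of [R] indexed by the bounded
   continuous functions on [X]. *)
Section stone_cech.
Variables (R : realType) (X : topologicalType).

Definition bcpower : topologicalType := prod_topology (fun _ : bcfun R X => R).

Definition bceval (x : X) : bcpower := fun f => set_val f x.

Definition beta : topologicalType := closure (range bceval).

Lemma bceval_closure (x : X) : bceval x \in closure (range bceval).
Proof. by apply/mem_set/subset_closure; exists x. Qed.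

Definition beta_in (x : X) : beta := exist _ (bceval x) (bceval_closure x).

End stone_cech.
Arguments beta_in R {X} x.

Section stone_cech_facts.
Variables (R : realType) (X : topologicalType).

Lemma bcpower_coord_continuous (f : bcfun R X) :
  continuous (fun p : bcpower R X => p f).
Proof. exact: (@proj_continuous _ (fun _ : bcfun R X => R) f). Qed.

Lemma bceval_continuous : continuous (@bceval R X).
Proof.
move=> x; apply/cvg_sup => f; move: x.
have /set_mem[cf _] := valP f.
exact: (@continuous_comp_initial _ X R (@^~ f) (@bceval R X)).
Qed.

Lemma beta_compact : compact [set: beta R X].
Proof.
have cK : compact (closure (range (@bceval R X))).
  have H (f : bcfun R X) : exists M : R, forall x, `|set_val f x| <= M.
    have /set_mem[_ [M [_ HM]]] := valP f.
    by exists (M + 1) => x; apply: HM => //; rewrite ltrDl.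
  pose M f := projT1 (cid (H f)).
  have HM f x : `|set_val f x| <= M f by rewrite /M; case: cid.
  pose K : set (bcpower R X) := [set p | forall f, `[- M f, M f]%classic (p f)].
  have cA : compact K.
    apply: (@tychonoff _ (fun _ : bcfun R X => R)
      (fun f => `[- M f, M f]%classic)).
    by move=> f; exact: segment_compact.
  apply: (subclosed_compact _ cA); first exact: closed_closure.
  have /closure_id -> : closed K.
    apply: compact_closed cA.
    by apply: hausdorff_product => f; exact: Rhausdorff.
  apply: closureS => _ [x _ <-] f /=.
  by rewrite in_itv /= -ler_norml; exact: HM.
move=> F FF _.
have [|p [Ap clp]] := cK (set_val @ F) (fmap_proper_filter _ FF).
  by apply: (@filterE _ F) => x; exact: set_valP.
exists (exist _ p (mem_set Ap)); split => // A B FA [C [[D oD <-] Dp] sCB].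
have FA' : (set_val @ F) (set_val @` A).
  by apply: (@filterS _ F _ A) => // x Ax; exists x.
have [q [Aq Dq]] := clp _ D FA' (open_nbhs_nbhs (conj oD Dp)).
case: Aq Dq => x Ax <- Dq; exists x; split => //; exact: sCB.
Qed.

Lemma beta_hausdorff : hausdorff_space (beta R X).
Proof.
have H : hausdorff_space (bcpower R X).
  by apply: hausdorff_product => f; exact: Rhausdorff.
move=> p q clpq; apply: val_inj; apply: H => A B nA nB.
have sc := @initial_continuous (closure (range (@bceval R X))) _ set_val.
have [r [Ar Br]] := clpq _ _ (sc p A nA) (sc q B nB).
by exists (set_val r).
Qed.

Lemma beta_in_continuous : continuous (@beta_in R X).
Proof.
apply: (@continuous_comp_initial _ _ _ set_val (@beta_in R X)).
exact: bceval_continuous.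
Qed.

Lemma beta_in_dense : dense (range (@beta_in R X)).
Proof.
move=> O [p Op] [D oD DO]; rewrite -DO in Op *.
have [q [[x _ xq] Dq]] := set_valP p D (open_nbhs_nbhs (conj oD Op)).
by rewrite -xq in Dq; exists (beta_in R x); split => //; exists x.
Qed.

Lemma beta_extension (f : X -> R) : continuous f -> bounded_fun f ->
  exists2 g : beta R X -> R, continuous g & forall x, g (beta_in R x) = f x.
Proof.
move=> cf bf; have fP : f \in bcfun R X by exact/mem_set.
exists (fun p => set_val p (exist _ f fP)) => // p.
apply: (@continuous_comp _ _ _ set_val (fun q : bcpower R X => q _)).
  exact: initial_continuous.
exact: bcpower_coord_continuous.
Qed.

Lemma beta_in_embedding (x : X) (A : set X) : completely_regular_space X ->
  nbhs x A -> exists2 B, nbhs (beta_in R x) B & beta_in R @^-1` B `<=` A.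
Proof.
move=> crX; rewrite nbhsE => -[U [oU Ux] UA].
have /(@uniform_separatorP X R)[f [cf f01 fx fU]] :
    uniform_separator [set x] (~` U) by apply: crX; [exact: open_closedC|].
have bf : bounded_fun f.
  exists 1; split => [|M M1 y _] //.
  have : f @` setT `<=` `[0, 1]%classic by [].
  move=> /(_ (f y)) /(_ (ex_intro2 _ _ y I erefl)) /=.
  rewrite in_itv /= => /andP[f0 f1]; rewrite ger0_norm //.
  exact: le_trans f1 (ltW M1).
have [g cg gE] := beta_extension cf bf.
exists (g @^-1` [set r | r < 1]) => [|y /=].
  have fx0 : f x = 0 by apply: fx; exists x.
  apply: cg; rewrite gE fx0; apply: open_nbhs_nbhs; split; first exact: open_lt.
  exact: ltr01.
rewrite gE => fy; apply: UA; apply: contrapT => nUy.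
by move: fy; rewrite (fU (f y)) ?ltxx//; exists y.
Qed.

Lemma beta_in_inj : tychonoff_space X -> injective (@beta_in R X).
Proof.
move=> [hX crX] x y xy; apply: hX => A B nA nB.
have [C nC CA] := beta_in_embedding crX nA.
exists y; split; last exact: nbhs_singleton.
by apply: CA; rewrite /preimage /= -xy; exact: nbhs_singleton.
Qed.

End stone_cech_facts.

(* The measurable types of the library are pointed, hence the argument [h]. *)
Definition pointed_space (Z : topologicalType) (h : inhabited Z) : Type := Z.

HB.instance Definition _ (Z : topologicalType) (h : inhabited Z) :=
  Choice.copy (pointed_space h) Z.
HB.instance Definition _ (Z : topologicalType) (h : inhabited Z) :=
  isPointed.Build (pointed_space h) (inhabited_witness h).

Definition borel (Z : topologicalType) (h : inhabited Z) :=
  g_sigma_algebraType (@open Z : set (set (pointed_space h))).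

Definition radon (R : realType) (Z : topologicalType) (h : inhabited Z)
    (mu : probability (borel h) R) :=
  forall B : set (borel h), measurable B -> forall e : R, 0 < e ->
  exists K : set Z, [/\ compact K, K `<=` B & (mu (B `\` K) < e%:E)%E].

(* A measure of the library is a function on all subsets, with unspecified
   values outside of the sigma-algebra; these values are set to 0 so that equal
   elements of [radon_prob] are exactly the measures equal on Borel sets. *)
Record radon_prob (R : realType) (Z : topologicalType) := RadonProb {
  rp_inh : inhabited Z;
  rp_mu : probability (borel rp_inh) R;
  rp_radon : radon rp_mu;
  rp_junk : forall B : set (borel rp_inh), ~ measurable B -> rp_mu B = 0%E }.

Lemma radon_prob_ext (R : realType) (Z : topologicalType)
    (mu nu : radon_prob R Z) :
  (forall B : set Z, <<s open >> B -> rp_mu mu B = rp_mu nu B) -> mu = nu.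
Proof.
case: mu => h mu rmu jmu; case: nu => h' nu rnu jnu /=.
have hh := Prop_irrelevance h' h; subst h' => E.
have {}E : mu = nu.
  have {}E : (mu : set (borel h) -> \bar R) = nu.
    apply/funext => B; have [mB|nB] := pselect (measurable B); first exact: E.
    by rewrite jmu// jnu.
  case: mu nu E {rmu jmu rnu jnu} => [m [c1 c2 c3 c4 c5 c6 c7]].
  move=> [n [d1 d2 d3 d4 d5 d6 d7]] /= E; subst n.
  have ec : c1 = d1
    by case: (c1) (d1) => ? ? [? ?]; congr isContent.Axioms_; exact: Prop_irrelevance.
  subst d1.
  have ? : c2 = d2
    by case: (c2) (d2) => ? [?]; congr Content_isMeasure.Axioms_; exact: Prop_irrelevance.
  have ? : c3 = d3
    by case: (c3) (d3) => ? [?]; congr isSFinite.Axioms_; exact: Prop_irrelevance.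
  have ? : c4 = d4
    by case: (c4) (d4) => ? [?]; congr isSigmaFinite.Axioms_; exact: Prop_irrelevance.
  have ? : c5 = d5
    by case: (c5) (d5) => ? [?]; congr isFinite.Axioms_; exact: Prop_irrelevance.
  have ? : c6 = d6
    by case: (c6) (d6) => ? [?]; congr isSubProbability.Axioms_; exact: Prop_irrelevance.
  have ? : c7 = d7
    by case: (c7) (d7) => ? [?]; congr isProbability.Axioms_; exact: Prop_irrelevance.
  by subst.
subst nu; congr RadonProb; exact: Prop_irrelevance.
Qed.

HB.instance Definition _ (R : realType) (Z : topologicalType) :=
  gen_eqMixin (radon_prob R Z).
HB.instance Definition _ (R : realType) (Z : topologicalType) :=
  gen_choiceMixin (radon_prob R Z).

Definition rp_int (R : realType) (Z : topologicalType) (f : Z -> R)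
    (mu : radon_prob R Z) : R :=
  \int[rp_mu mu]_x f x.

HB.instance Definition _ (R : realType) (Z : topologicalType) :=
  Topological.copy (radon_prob R Z)
    (sup_topology (fun f : bcfun R Z =>
       Topological.class (initial_topology (rp_int (set_val f))))).

Definition fin_supp_prob (R : realType) (X : topologicalType) :
    set (radon_prob R (beta R X)) :=
  [set mu | exists n (x : 'I_n -> X) (w : 'I_n -> R),
    [/\ forall i, 0 <= w i, \sum_(i < n) w i = 1 &
      forall B : set (borel (rp_inh mu)), measurable B ->
        rp_mu mu B =
        (\sum_(i < n) (w i)%:E * \d_(beta_in R (x i) : borel (rp_inh mu)) B)%E]].
Arguments fin_supp_prob : clear implicits.

(* Main.v *)
(* Call two points of [beta X] equivalent when they agree on a countable family
   of continuous functions. Restricted to averages of [n] Dirac measures, [f] is a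
   continuous function on [X^n]; a transfinite induction of length [omega_1]
   together with Grothendieck's double limit argument shows that it is invariant
   under replacing points by equivalent ones, for a suitable countable family.
   Let [l] be the countable lattice generated by this family. If two measures
   agree on [l], they are simultaneous limits of averages of Dirac measures at
   pairwise equivalent points: a linear functional separating them from these
   averages would be blocked by a function of [l], by compactness. Hence [f]
   takes equal values on elements of [Y] that agree on [l]. As [Y] is
   pseudocompact and dense, every measure agrees on [l] with an element of [Y], so
   [f] descends to the metrizable image of [P (beta X)] under integration of [l],
   where pseudocompactness of [Y] again makes it continuous. *)
Require Import Defs.
From HB Require Import structures.
From mathcomp Require Import all_boot all_order all_algebra.
From mathcomp Require Import all_classical all_reals all_analysis.
From mathcomp Require Import finmap wochoice measurable_realfun ring lra.
Import Order.TTheory GRing.Theory Num.Theory.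
Import numFieldNormedType.Exports.
Local Open Scope classical_set_scope.
Local Open Scope ring_scope.
Set Implicit Arguments.
Unset Strict Implicit.

(** * Pseudocompactness *)

Lemma continuous_pair (T U V : topologicalType) (f : T -> U) (g : T -> V) :
  continuous f -> continuous g -> continuous (fun t => (f t, g t)).
Proof. by move=> cf cg t; apply: cvg_pair; [exact: cf|exact: cg]. Qed.

Lemma continuous_fst (T U : topologicalType) : continuous (fun p : T * U => p.1).
Proof. by move=> p; exact: cvg_fst. Qed.

Lemma continuous_snd (T U : topologicalType) : continuous (fun p : T * U => p.2).
Proof. by move=> p; exact: cvg_snd. Qed.

Lemma continuous_cst (T U : topologicalType) (u : U) : continuous (fun _ : T => u).
Proof. by move=> p; exact: cvg_cst. Qed.

Lemma continuousB (R : realType) (Z : topologicalType) (f g : Z -> R) :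
  continuous f -> continuous g -> continuous (fun z => f z - g z).
Proof. by move=> cf cg z; apply: cvgB; [exact: cf|exact: cg]. Qed.

Lemma continuous_norm (R : realType) (Z : topologicalType) (f : Z -> R) :
  continuous f -> continuous (fun z => `|f z|).
Proof. by move=> cf z; apply: cvg_norm; exact: cf. Qed.

Lemma continuous_scale (R : realType) (Z : topologicalType) (c : R) (g : Z -> R) :
  continuous g -> continuous (fun z => c * g z).
Proof. by move=> cg z; apply: cvgM; [exact: cvg_cst|exact: cg]. Qed.

Lemma continuous_sum (R : realType) (Z : topologicalType) (I : Type) (r : seq I)
    (F : I -> Z -> R) :
  (forall i, continuous (F i)) -> continuous (fun z => \sum_(i <- r) F i z).
Proof.
move=> cF; elim: r => [|i r IH].
  by under eq_fun do rewrite big_nil; move=> z; exact: cvg_cst.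
under eq_fun do rewrite big_cons.
by move=> z; apply: cvgD; [exact: cF|exact: IH].
Qed.

Lemma continuous_distP (R : realType) (Z : topologicalType) (f : Z -> R) :
  continuous f <-> forall x e, 0 < e -> \forall y \near x, `|f y - f x| < e.
Proof.
split=> [cf x e e0|H x].
  have /cvgrPdist_lt/(_ e e0) := cf x.
  by apply: filterS => y; rewrite distrC.
by apply/cvgrPdist_lt => e e0; apply: filterS (H x e e0) => y; rewrite distrC.
Qed.

Lemma bounded_funI (R : realType) (T : Type) (f : T -> R) (M : R) :
  (forall x, `|f x| <= M) -> bounded_fun f.
Proof.
move=> HM; exists M; split; first exact: num_real.
by move=> N MN x _; exact: le_trans (HM x) (ltW MN).
Qed.

Lemma bounded_funE (R : realType) (Z : Type) (f : Z -> R) :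
  bounded_fun f -> exists2 M : R, 0 < M & forall z, `|f z| <= M.
Proof.
move=> [M [_ HM]]; exists (`|M| + 1) => [|z]; first by rewrite ltr_wpDl.
by apply: (HM _ _ z I); rewrite (le_lt_trans (ler_norm M)) ?ltrDl.
Qed.

(** The reciprocal of [f] is continuous, hence bounded. This is how pseudocompactness enters
    [pseudocompact_hit] and the final extension. *)
Lemma pseudocompact_lbound (R : realType) (Z : topologicalType) (f : Z -> R) :
  pseudocompact R Z -> continuous f -> (forall z, 0 < f z) ->
  exists2 c : R, 0 < c & forall z, c <= f z.
Proof.
move=> pcZ cf f0.
have cV : continuous (fun z => (f z)^-1).
  by move=> z; apply: cvgV; [exact/lt0r_neq0|exact: cf].
have [M M0 HM] := bounded_funE (pcZ _ cV).
exists M^-1; first by rewrite invr_gt0.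
move=> z; rewrite -[f z]invrK lef_pV2 ?posrE ?invr_gt0//.
exact: le_trans (ler_norm _) (HM z).
Qed.

Section gap.
Variables (R : realType) (Z : topologicalType) (g : nat -> Z -> R) (l : nat -> R).

Definition gap_term (n : nat) (z : Z) : R := Num.min n.+1%:R^-1 `|g n z - l n|.

(* A pseudometric distance from [(g n z)_n] to [l] in the product topology. *)
Definition gap (z : Z) : R := sup [set gap_term n z | n in [set: nat]].

Lemma gap_term_ge0 n z : 0 <= gap_term n z.
Proof. by rewrite le_min normr_ge0 invr_ge0 ler0n. Qed.

Lemma gap_term_leV n z : gap_term n z <= n.+1%:R^-1.
Proof. by rewrite ge_min lexx. Qed.

Lemma gap_le z e : (forall n, gap_term n z <= e) -> gap z <= e.
Proof.
move=> H; apply: ge_sup; first by exists (gap_term 0 z); exists 0%N.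
by move=> _ [n _ <-].
Qed.

Lemma gap_term_le n z : gap_term n z <= gap z.
Proof.
apply: ub_le_sup; last by exists n.
exists 1 => _ [k _ <-]; apply: le_trans (gap_term_leV _ _) _.
by rewrite invf_le1 ?ltr0n// ler1n.
Qed.

Lemma gap_ge0 z : 0 <= gap z.
Proof. exact: le_trans (gap_term_ge0 0 z) (gap_term_le 0 z). Qed.

Lemma gap_eq0 z : gap z = 0 -> forall n, g n z = l n.
Proof.
move=> gz n; have := gap_term_le n z; rewrite gz ge_min.
rewrite leNgt invr_gt0 ltr0n/= normr_le0 subr_eq0.
by move/eqP.
Qed.

(** The cap [n.+1%:R^-1] leaves only finitely many coordinates to control. *)
Lemma gap_approx e : 0 < e ->
  exists N, forall z, (forall n, (n < N)%N -> `|g n z - l n| <= e) -> gap z <= e.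
Proof.
move=> e0; have [N _ HN] := near_infty_natSinv_lt (PosNum e0).
exists N => z H; apply: gap_le => n.
have [nN|Nn] := ltnP n N; first by rewrite ge_min H ?orbT.
by rewrite (le_trans (gap_term_leV _ _))// ltW//; exact: HN.
Qed.

Lemma gap_continuous : (forall n, continuous (g n)) -> continuous gap.
Proof.
move=> cg; apply/continuous_distP => z e e0.
have e20 : 0 < e / 2 by rewrite divr_gt0.
have [N _ HN] := near_infty_natSinv_lt (PosNum e20).
have : \forall y \near z, forall n, (n < N)%N -> `|g n y - g n z| < e / 2.
  elim: N {HN} => [|N IH]; first by apply: nearW.
  have /continuous_distP/(_ z _ e20) H := cg N.
  near=> y => n; rewrite ltnS leq_eqVlt => /predU1P[->|]; first by near: y.
  by move: n; near: y.
apply: filterS => y H.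
have key u v : (forall n, (n < N)%N -> `|g n u - g n v| < e / 2) ->
    gap u <= gap v + e / 2.
  move=> Huv; apply: gap_le => n.
  apply: (@le_trans _ _ (gap_term n v + e / 2)); last first.
    by rewrite lerD2r gap_term_le.
  have [nN|Nn] := ltnP n N; last first.
    rewrite (le_trans (gap_term_leV _ _))// ltW// ltr_wpDl ?gap_term_ge0//.
    exact: HN.
  rewrite /gap_term -lerBlDr le_min !lerBlDr; apply/andP; split.
    by rewrite (le_trans (gap_term_leV _ _))// lerDl ltW.
  rewrite ge_min; apply/orP; right.
  have eq : g n u - l n = (g n v - l n) + (g n u - g n v) by ring.
  rewrite eq; have := ler_normD (g n v - l n) (g n u - g n v).
  by have := ltW (Huv n nN) => ? ?; lra.
rewrite ltr_norml; have := key y z H.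
have := key z y (fun n nN => eq_ind_r (fun t => t < e / 2) (H n nN) (distrC _ _)).
by move=> ? ?; apply/andP; split; lra.
Unshelve. all: by end_near. Qed.

End gap.

(** If the values [l] were never attained, [gap g l] would be continuous and positive, hence bounded
    below by some [c], against an approximation up to [c / 2]. *)
Lemma pseudocompact_hit (R : realType) (Z : topologicalType) (g : nat -> Z -> R)
    (l : nat -> R) : pseudocompact R Z -> (forall n, continuous (g n)) ->
  (forall N e, 0 < e -> exists z, forall n, (n < N)%N -> `|g n z - l n| <= e) ->
  exists z, forall n, g n z = l n.
Proof.
move=> pcZ cg H; apply: contrapT => nH.
have pos z : 0 < gap g l z.
  rewrite lt_neqAle gap_ge0 andbT eq_sym; apply/negP => /eqP/gap_eq0 gz.
  by apply: nH; exists z.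
have [c c0 Hc] := pseudocompact_lbound pcZ (gap_continuous cg) pos.
have c20 : 0 < c / 2 by rewrite divr_gt0.
have [N HN] := gap_approx g l c20.
have [z Hz] := H N _ c20.
by have := HN z Hz; have := Hc z; lra.
Qed.

Section feebly_compact.
Variables (R : realType) (X : topologicalType).
Hypotheses (crX : completely_regular_space X) (pcX : pseudocompact R X).

Lemma bump (U : set X) (x : X) : open U -> U x ->
  exists f : X -> R, [/\ continuous f, f x = 1, forall y, 0 <= f y &
    forall y, ~ U y -> f y = 0].
Proof.
move=> oU Ux.
have /(@uniform_separatorP X R)[f [cf f01 fx fU]] :
    uniform_separator [set x] (~` U) by apply: crX; [exact: open_closedC|].
exists (fun y => 1 - f y); split.
- by move=> y; apply: cvgB; [exact: cvg_cst|exact: cf].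
- by rewrite (fx (f x)) ?subr0//; exists x.
- move=> y; have /f01 /= : range f (f y) by exists y.
  by rewrite in_itv/= subr_ge0 => /andP[].
- by move=> y nUy; rewrite (fU (f y)) ?subrr//; exists y.
Qed.

(** Without such a point the sets [Q n] form a locally finite family, and the sum of [n] times a
    bump inside [Q n] is continuous but unbounded. *)
Lemma pseudocompact_accumulation (Q : nat -> set X) :
  (forall n, open (Q n)) -> (forall n, Q n !=set0) ->
  exists z : X, forall T : set X, nbhs z T ->
    forall N, exists2 n, (N <= n)%N & T `&` Q n !=set0.
Proof.
move=> oQ Q0; apply: contrapT => nacc.
have lf (z : X) : exists (T : set X) N, nbhs z T /\ forall n, (N <= n)%N -> T `&` Q n = set0.
  apply: contrapT => H; apply: nacc; exists z => T zT N; apply: contrapT => H'.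
  apply: H; exists T, N; split=> // n Nn; apply: contrapT => /eqP/set0P TQ.
  by apply: H'; exists n.
have [T /choice[N TN]] := choice lf.
have [x Qx] := choice Q0.
have [h Hh] := choice (fun n => bump (oQ n) (Qx n)).
have hout z n y : (N z <= n)%N -> T z y -> h n y = 0.
  move=> Nn Ty; have [_ _ _ ->//] := Hh n => Qy.
  by have := (TN z).2 n Nn; rewrite -subset0 => /(_ y); apply.
(* The locally finite sum, cut at an index [N y] beyond which the terms vanish on [T y]; on [T z] it
   equals the finite sum up to [N z]. *)
pose H y : R := \sum_(n < N y) n%:R * h n y.
have HE y M : (N y <= M)%N -> H y = \sum_(n < M) n%:R * h n y.
  move=> yM; rewrite /H -!(big_mkord xpredT (fun n => n%:R * h n y))//.
  rewrite (big_cat_nat (leq0n _) yM)//= [X in _ + X]big_nat_cond [X in _ + X]big1 ?addr0//.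
  move=> n /andP[/andP[Nn _] _]; rewrite (hout y)// ?mulr0//.
  exact: nbhs_singleton (TN y).1.
have HT z y : T z y -> H y = \sum_(n < N z) n%:R * h n y.
  move=> Ty; rewrite (HE y (maxn (N z) (N y))) ?leq_maxr//.
  rewrite -!(big_mkord xpredT (fun n => n%:R * h n y))//.
  rewrite (big_cat_nat (leq0n _) (leq_maxl (N z) (N y)))//=.
  rewrite [X in _ + X]big_nat_cond [X in _ + X]big1 ?addr0//.
  by move=> n /andP[/andP[Nn _] _]; rewrite (hout z)// ?mulr0.
have cH : continuous H.
  move=> z; have cS : {for z, continuous (fun y => \sum_(n < N z) n%:R * h n y)}.
    apply: continuous_sum => n y; apply: cvgM; first exact: cvg_cst.
    by have [+ _ _ _] := Hh n; apply.
  rewrite /continuous_at (HT z z (nbhs_singleton (TN z).1)).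
  apply: cvg_trans cS; apply: near_eq_cvg.
  by apply: filterS (TN z).1 => y Ty; apply/esym; exact: HT.
have [M M0 HM] := bounded_funE (pcX cH).
pose n := Num.bound M.
have nM : M < n%:R by apply: archi_boundP; exact: ltW.
have Hn : n%:R <= H (x n).
  rewrite (HE _ (maxn n.+1 (N (x n)))) ?leq_maxr//.
  rewrite (bigD1 (Ordinal (leq_maxl n.+1 (N (x n)) : n < _)%N))//=.
  have [_ -> _ _] := Hh n; rewrite mulr1 lerDl; apply: sumr_ge0 => i _.
  by have [_ _ h0 _] := Hh i; rewrite mulr_ge0.
have := le_trans Hn (le_trans (ler_norm _) (HM (x n))).
by rewrite leNgt nM.
Qed.

End feebly_compact.

(** * Limits along ultrafilters *)

Lemma filter_all_in (T : Type) (I : eqType) (F : set_system T) (s : seq I)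
    (P : I -> set T) : Filter F -> (forall i, i \in s -> F (P i)) ->
  F [set t | forall i, i \in s -> P i t].
Proof.
move=> FF; elim: s => [|i s IH] H; first by apply: filterE.
have H1 : F (P i) by apply: H; rewrite mem_head.
have H2 : F [set t | forall i, i \in s -> P i t].
  by apply: IH => j js; apply: H; rewrite in_cons js orbT.
apply: filterS (filterI H1 H2) => t [Pi Ps] j.
by rewrite in_cons => /predU1P[->//|]; exact: Ps.
Qed.

(** Compactness of the segment gives a cluster point, and an ultrafilter converges to each of its
    cluster points. *)
Lemma ultra_cvg (R : realType) (U : set_system nat) (u : nat -> R) (M : R) :
  UltraFilter U -> (forall n, `|u n| <= M) -> exists l : R, u n @[n --> U] --> l.
Proof.
move=> UU uM.
have [l [_ cl]] : `[- M, M]%classic `&` cluster (u n @[n --> U]) !=set0.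
  apply: segment_compact; apply: (@filterE _ U) => n /=.
  by rewrite in_itv/= -ler_norml.
exists l => A lA; have [//|UA] := in_ultra_setVsetC (u @^-1` A) UU.
have [x [nAx Ax]] := cl (~` A) A UA lA; by case: (nAx Ax).
Qed.

Section limit_continuity.
Variables (R : realType) (X : topologicalType).
Hypotheses (crX : completely_regular_space X) (pcX : pseudocompact R X).

(* [s] lists the points chosen so far in the proof of [limit_continuity]. *)
Lemma limit_continuity_step (E : X * X -> R) (U : set_system nat)
    (z : nat -> X) (q : X -> R) (x0 : X) (e : R) :
  continuous E -> (forall x, 0 <= E x) -> (forall x, E (x0, x) = 0) ->
  ProperFilter U -> (forall x, E (x, z n) @[n --> U] --> q x) -> 0 < e ->
  forall (s : seq X) (O : set X) (x : X), O x -> e <= q x ->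
    (forall y, y \in s -> e <= q y) -> open O -> O x0 ->
    exists Q V : set X,
    [/\ (open Q /\ Q !=set0), (forall y t, y \in x :: s -> Q t -> 2 / 3 * e < E (y, t)),
      (open V /\ V x0), V `<=` O & forall y t, V y -> Q t -> E (y, t) < e / 3].
Proof.
move=> cE E0 Ex0 UU Eq e0 s O x Ox qx qs oO Ox0.
have He y : y \in x :: s -> e <= q y by rewrite in_cons => /predU1P[->|/qs].
have lt23 : 2 / 3 * e < e by lra.
have FU : U [set n | forall y, y \in x :: s -> 2 / 3 * e < E (y, z n)].
  apply: filter_all_in => y ys.
  have /cvgrPdist_lt/(_ (e / 3)) := Eq y.
  rewrite divr_gt0// => /(_ isT); apply: filterS => n.
  by rewrite ltr_norml => /andP[_]; have := He y ys => ? ?; lra.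
have [n /= Hn] := filter_ex FU.
have nQ : nbhs (z n) [set t | forall y, y \in x :: s -> 2 / 3 * e < E (y, t)].
  apply: filter_all_in => y ys.
  have cEy : {for z n, continuous (fun t => E (y, t))}.
    apply: (@continuous_comp _ _ _ (fun t => (y, t)) E); last exact: cE.
    by apply: cvg_pair; [exact: cvg_cst|exact: cvg_id].
  by apply: (cEy [set r | 2 / 3 * e < r]); apply: open_nbhs_nbhs; split;
    [exact: open_gt|exact: Hn].
have : nbhs (x0, z n) [set p | E p < e / 3].
  apply: (cE (x0, z n) [set r | r < e / 3]); apply: open_nbhs_nbhs; split.
    exact: open_lt.
  by rewrite /= Ex0 divr_gt0.
case=> -[A B] /= [nA nB] AB.
exists ([set t | forall y, y \in x :: s -> 2 / 3 * e < E (y, t)]`&` B)^°, (A^° `&` O).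
split.
- split; first exact: open_interior.
  by exists (z n); exact: nbhs_singleton (nbhs_interior (filterI nQ nB)).
- by move=> y t ys /interior_subset[+ _]; apply.
- split; first by apply: openI => //; exact: open_interior.
  by split=> //; exact: nbhs_singleton (nbhs_interior nA).
- by move=> y [].
- move=> y t [/interior_subset Ay _] /interior_subset[_ Bt].
  exact: (AB (y, t)).
Qed.

(* Otherwise there are points [x k] and open sets [Q k] for which
   [E' (x, t) = |E (x, t) - E (x0, t)|] is large on [x i, Q k] for [i <= k] and
   small for [i > k]: an accumulation point [t] of [Q], and then one of the points
   near [x i] where [E' (_, t)] is still large, contradict each other. *)
Lemma limit_continuity (E : X * X -> R) (U : set_system nat) (z : nat -> X)
    (q : X -> R) : continuous E -> ProperFilter U ->
  (forall x, E (x, z n) @[n --> U] --> q x) -> continuous q.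
Proof.
move=> cE UU Eq; apply/continuous_distP => x0 e e0; apply: contrapT => nq.
pose E' p := `|E p - E (x0, p.2)|.
pose q' x := `|q x - q x0|.
have cE' : continuous E'.
  move=> p; apply: cvg_norm; apply: cvgB; first exact: cE.
  apply: (@continuous_comp _ _ _ (fun p : X * X => (x0, p.2)) E); last exact: cE.
  by apply: cvg_pair; [exact: cvg_cst|exact: cvg_snd].
have Eq' x : E' (x, z n) @[n --> U] --> q' x.
  by apply: cvg_norm; apply: cvgB; exact: Eq.
have step (st : seq X * set X) : exists r : X * set X * set X,
    (forall y, y \in st.1 -> e <= q' y) -> open st.2 -> st.2 x0 ->
    [/\ (st.2 r.1.1 /\ e <= q' r.1.1), (open r.1.2 /\ r.1.2 !=set0),
      (forall y t, y \in r.1.1 :: st.1 -> r.1.2 t -> 2 / 3 * e < E' (y, t)),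
      [/\ open r.2, r.2 x0 & r.2 `<=` st.2] &
      forall y t, r.2 y -> r.1.2 t -> E' (y, t) < e / 3].
  case: st => s O /=.
  (* States violating the invariant get a default triple, since [choice] needs a total function. *)
  have [[qs oO Ox0]|H] := pselect [/\ forall y, y \in s -> e <= q' y, open O & O x0];
    last by exists (x0, setT, setT) => *; exfalso; apply: H.
  have [x [Ox qx]] : exists x, O x /\ e <= q' x.
    apply: contrapT => H; apply: nq.
    apply: filterS (open_nbhs_nbhs (conj oO Ox0)) => y Oy; rewrite ltNge.
    by apply/negP => ey; apply: H; exists y.
  have E0 p : 0 <= E' p by exact: normr_ge0.
  have Ex0 t : E' (x0, t) = 0 by rewrite /E' subrr normr0.
  have [Q [V [[? ?] ? [? ?] ? ?]]] :=
    limit_continuity_step cE' E0 Ex0 UU Eq' e0 Ox qx qs oO Ox0.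
  by exists (x, Q, V).
have {step}[f Hf] := choice step.
(* The state is the list of the points chosen so far together with the current neighbourhood of
   [x0]. *)
pose st := fix st k := if k is k'.+1 then
  ((f (st k')).1.1 :: (st k').1, (f (st k')).2) else ([::], [set: X]).
pose x k := (f (st k)).1.1; pose Q k := (f (st k)).1.2; pose O k := (st k).2.
have inv k : [/\ forall y, y \in (st k).1 -> e <= q' y, open (st k).2 & (st k).2 x0].
  elim: k => [|k [IH1 IH2 IH3]] /=; first by split=> //; exact: openT.
  have [[_ qx] _ _ [oO Ox0 _] _] := Hf _ IH1 IH2 IH3.
  by split=> // y; rewrite in_cons => /predU1P[->|/IH1].
have H k := let: And3 i1 i2 i3 := inv k in Hf _ i1 i2 i3.
have Omono i k : (i <= k)%N -> O k `<=` O i.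
  elim: k => [|k IH]; first by rewrite leqn0 => /eqP ->.
  rewrite leq_eqVlt => /predU1P[->//|/IH]; apply: subset_trans.
  by have [_ _ _ [_ _]] := H k.
have xst i k : (i <= k)%N -> x i \in x k :: (st k).1.
  elim: k => [|k IH]; first by rewrite leqn0 => /eqP ->; rewrite mem_head.
  rewrite leq_eqVlt => /predU1P[->|/IH]; first by rewrite mem_head.
  by move=> xk; rewrite in_cons; apply/orP; right.
have oQ k : open (Q k) by have [_ [? ?] _ _ _] := H k.
have Q0 k : Q k !=set0 by have [_ [? ?] _ _ _] := H k.
have [t Ht] := pseudocompact_accumulation crX pcX oQ Q0.
have cEl y : continuous (fun t => E' (y, t)).
  move=> t'; apply: (@continuous_comp _ _ _ (fun t => (y, t)) E'); last exact: cE'.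
  by apply: cvg_pair; [exact: cvg_cst|exact: cvg_id].
have cEr y : continuous (fun t => E' (t, y)).
  move=> t'; apply: (@continuous_comp _ _ _ (fun t => (t, y)) E'); last exact: cE'.
  by apply: cvg_pair; [exact: cvg_id|exact: cvg_cst].
have big i : 2 / 3 * e <= E' (x i, t).
  rewrite leNgt; apply/negP => lt.
  have /Ht/(_ i)[k ik [t' [/= lt' Qt']]] : nbhs t [set t' | E' (x i, t') < 2 / 3 * e].
    by apply: (cEl (x i) t [set r | r < 2 / 3 * e]); apply: open_nbhs_nbhs; split;
      [exact: open_lt|].
  have [_ _ H3 _ _] := H k.
  by have := H3 (x i) t' (xst _ _ ik) Qt'; rewrite ltNge ltW.
(* Points of [O i] have small [E'] against every [Q k] with [k < i]; those of [G i] still have a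
   large value at [t]. An accumulation point of the [G i] inherits both. *)
pose G i := O i `&` [set y | e / 2 < E' (y, t)].
have oG i : open (G i).
  apply: openI; first by have [_ ? _] := inv i.
  apply: (@open_comp _ _ (fun y => E' (y, t)) [set r | e / 2 < r]).
    by move=> y _; exact: cEr.
  exact: open_gt.
have G0 i : G i !=set0.
  exists (x i); split; first by have [[? ?] _ _ _ _] := H i.
  by rewrite /=; have := big i => ?; lra.
have [y Hy] := pseudocompact_accumulation crX pcX oG G0.
have y1 : e / 2 <= E' (y, t).
  rewrite leNgt; apply/negP => lt.
  have /Hy/(_ 0)[k _ [y' [/= lt' [_ /= gt']]]] : nbhs y [set y' | E' (y', t) < e / 2].
    by apply: (cEr t y [set r | r < e / 2]); apply: open_nbhs_nbhs; split;
      [exact: open_lt|].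
  by move: lt'; rewrite ltNge ltW.
have y2 k t' : Q k t' -> E' (y, t') <= e / 3.
  move=> Qt'; rewrite leNgt; apply/negP => lt.
  have /Hy/(_ k.+1)[i ki [y' [/= lt' [Oy' _]]]] : nbhs y [set y' | e / 3 < E' (y', t')].
    by apply: (cEr t' y [set r | e / 3 < r]); apply: open_nbhs_nbhs; split;
      [exact: open_gt|].
  have [_ _ _ _ H5] := H k.
  by have := H5 y' t' (Omono _ _ ki _ Oy') Qt'; rewrite ltNge ltW.
have /Ht/(_ 0)[k _ [t' [/= lt' Qt']]] : nbhs t [set t' | e / 3 < E' (y, t')].
  apply: (cEl y t [set r | e / 3 < r]); apply: open_nbhs_nbhs; split.
    exact: open_gt.
  by rewrite /=; lra.
by have := y2 k t' Qt'; rewrite leNgt lt'.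
Qed.

End limit_continuity.

(** * Precaliber [omega_1] and the first uncountable ordinal *)

Lemma cvg_lbound (R : realType) (T : Type) (U : set_system T) (u : T -> R)
    (l c : R) : ProperFilter U -> u n @[n --> U] --> l ->
  U [set n | c <= u n] -> c <= l.
Proof.
move=> UU ul Uc; rewrite leNgt; apply/negP => lc.
have cl0 : 0 < c - l by rewrite subr_gt0.
have /cvgrPdist_lt/(_ _ cl0) H := ul.
have [n [/= + cn]] := filter_ex (filterI H Uc).
by rewrite ltr_norml => /andP[+ _]; move: cn => /= ? ?; lra.
Qed.

(** By [pseudocompact_hit] the countably many limits along [U] are attained at a single point of
    [X], a substitute for convergence of the sequence [x] itself. *)
Lemma pseudocompact_ultra_cvg (R : realType) (X : topologicalType)
    (U : set_system nat) (g : nat -> X -> R) (x : nat -> X) :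
  pseudocompact R X -> UltraFilter U -> (forall n, continuous (g n)) ->
  exists y, forall n, g n (x k) @[k --> U] --> g n y.
Proof.
move=> pcX UU cg.
have Hl n : exists l : R, g n (x k) @[k --> U] --> l.
  have [M _ HM] := bounded_funE (pcX (g n) (cg n)).
  by apply: (@ultra_cvg R U (fun k => g n (x k)) M).
have [l Hl'] := choice Hl.
have [|y Hy] := @pseudocompact_hit R X g l pcX cg; last first.
  by exists y => n; rewrite Hy.
move=> N e e0.
have : U [set k | forall n, n \in iota 0 N -> `|g n (x k) - l n| <= e].
  apply: filter_all_in => n _.
  have /cvgrPdist_lt/(_ e e0) := Hl' n.
  by apply: filterS => k; rewrite distrC => /ltW.
move=> /filter_ex[k Hk]; exists (x k) => n nN; apply: Hk.
by rewrite mem_iota.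
Qed.

(* Precaliber [omega_1] and pseudocompactness merged into one property which,
   unlike pseudocompactness, is stable under finite products. *)
Definition spread (W : topologicalType) :=
  forall (I : Type) (S : set I) (O : I -> set W), ~ countable S ->
    (forall i, S i -> open (O i) /\ O i !=set0) ->
  exists S' : set I, [/\ S' `<=` S, ~ countable S' &
    forall s : nat -> I, (forall k, S' (s k)) ->
      exists w, forall k, closure (O (s k)) w].

Lemma spread_subsingleton (W : topologicalType) :
  (forall w w' : W, w = w') -> spread W.
Proof.
move=> W1 I S O nS SO; exists S; split=> // s Ss.
have [w Ow] := (SO _ (Ss 0)).2; exists w => k; apply: subset_closure.
by have [w' Ow'] := (SO _ (Ss k)).2; rewrite (W1 w w').
Qed.

(** Each open set is shrunk to a box and the index set is thinned twice, once per factor; the points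
    obtained in the two factors combine. *)
Lemma spread_prod (W Z : topologicalType) : spread W -> spread Z -> spread (W * Z)%type.
Proof.
move=> sW sZ I S O nS SO.
have box i : exists AB : set W * set Z, S i ->
    [/\ open AB.1, AB.1 !=set0, open AB.2, AB.2 !=set0 & AB.1 `*` AB.2 `<=` O i].
  have [Si|nSi] := pselect (S i); last by exists (setT, setT).
  have [oO [[w z] Owz]] := SO i Si.
  have [[A B] /= [nA nB] AB] := open_nbhs_nbhs (conj oO Owz : open_nbhs _ _).
  exists (A^°, B^°) => _; split => /=; [exact: open_interior| |exact: open_interior| |].
  - by exists w; exact: nbhs_singleton (nbhs_interior nA).
  - by exists z; exact: nbhs_singleton (nbhs_interior nB).
  - by move=> p [/interior_subset ? /interior_subset ?]; exact: AB.
have [AB HAB] := choice box.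
have [|S1 [S1S nS1 HS1]] := sW I S (fun i => (AB i).1) nS.
  by move=> i /HAB[].
have [|S2 [S2S nS2 HS2]] := sZ I S1 (fun i => (AB i).2) nS1.
  by move=> i /S1S/HAB[].
exists S2; split=> //; first exact: subset_trans S1S.
move=> s Ss; have [w Hw] := HS1 s (fun k => S2S _ (Ss k)).
have [z Hz] := HS2 s Ss; exists (w, z) => k B [[P Q] /= [nP nQ] PQ].
have [w' [Aw Pw]] := Hw k _ nP; have [z' [Bz Qz]] := Hz k _ nQ.
exists (w', z'); split; last exact: PQ.
by have [_ _ _ _] := HAB _ (S1S _ (S2S _ (Ss k))); apply.
Qed.

(** In a subfamily with the finite intersection property, the finite intersections along a sequence
    accumulate at some point, which lies in all the closures. *)
Lemma spread_pseudocompact (R : realType) (X : topologicalType) :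
  completely_regular_space X -> pseudocompact R X -> precaliber_omega1 X ->
  spread X.
Proof.
move=> crX pcX preX I S O nS SO.
(* Precaliber concerns sets of open sets, not indexed families: if only countably many sets occur,
   one of them occurs uncountably often. *)
have [cO|nO] := pselect (countable (O @` S)).
  have [v Hv] : exists v, ~ countable (S `&` O @^-1` [set v]).
    apply: contrapT => H; apply: nS.
    suff : countable (\bigcup_(v in O @` S) (S `&` O @^-1` [set v])).
      apply: sub_countable; apply: subset_card_le => i Si.
      by exists (O i) => //; exists i.
    by apply: bigcup_countable => // v _; apply: contrapT => nv; apply: H; exists v.
  exists (S `&` O @^-1` [set v]); split=> [i []//|//|s Ss].
  have [x Ox] := (SO _ (Ss 0).1).2; exists x => k; apply: subset_closure.
  by rewrite (Ss k).2 -(Ss 0).2.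
have oO : O @` S `<=` open by move=> _ [i /SO[? _] <-].
have [V [VS nV fV]] := preX _ oO nO.
exists (S `&` O @^-1` V); split=> [i []//| |s Ss].
  move=> cS; apply: nV; suff : countable (O @` (S `&` O @^-1` V)).
    apply: sub_countable; apply: subset_card_le => v Vv.
    by have [i Si iv] := VS v Vv; exists i => //; split=> //=; rewrite iv.
  exact: sub_countable (card_image_le _ _) cS.
pose Q k := [set x | forall i, i \in iota 0 k.+1 -> O (s i) x].
have oQ k : open (Q k).
  rewrite openE => x Qx; apply: filter_all_in => i ik.
  by apply: open_nbhs_nbhs; split; [apply: (SO _ (Ss i).1).1|exact: Qx].
have Q0 k : Q k !=set0.
  have fV' (r : seq (set X)) : (forall v, v \in r -> V v) ->
      exists x, forall v, v \in r -> v x.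
    move=> rV; have [|x Hx] := fV [fset v in r]%fset.
      by move=> v; rewrite !inE => /rV ?; exact/mem_set.
    by exists x => v vr; apply: (Hx v) => /=; rewrite !inE.
  have [|x Hx] := fV' [seq O (s i) | i <- iota 0 k.+1].
    by move=> v /mapP[i _ ->]; exact: (Ss i).2.
  by exists x => i ik; apply: Hx; apply: map_f.
have [x Hx] := pseudocompact_accumulation crX pcX oQ Q0.
exists x => k B /Hx/(_ k)[n kn [y [By Qy]]]; exists y; split=> //.
by apply: Qy; rewrite mem_iota.
Qed.

Lemma uncountable_powerset_nat : ~ countable [set: set nat].
Proof.
move=> /countable_injP[f fI].
pose D := [set n | exists2 A, f A = n & ~ A n].
have [Df|nDf] := pselect (D (f D)).
  have [A fA nA] := Df.
  have AD : A = D by apply: fI => //; exact: in_setT.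
  by apply: nA; rewrite AD.
by apply: (nDf); exists D.
Qed.

(* [A] is a copy of the first uncountable ordinal. *)
Lemma omega1_exists : exists (T : Type) (lt : T -> T -> Prop) (A : set T),
  [/\ well_founded lt, (forall x y z, lt x y -> lt y z -> lt x z),
    (forall x y, [\/ lt x y, x = y | lt y x]), ~ countable A &
    forall x, A x -> countable [set y | lt y x]].
Proof.
have [W wW] := well_ordering_principle (set nat).
have minW (P : set (set nat)) : P !=set0 ->
    exists2 m, P m & forall y, P y -> W m y.
  move=> [x Px]; have [|m [[Pm mP] _]] := wW (fun x => `[< P x >]).
    by exists x; apply/asboolP.
  exists m; first exact/asboolP.
  by move=> y Py; apply: mP; apply/asboolP.
(* Antisymmetry is extracted from the uniqueness of the least element of [{x, y}]. *)
have anti x y : W x y -> W y x -> x = y.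
  move=> xy yx; have [|m [_ mU]] := wW (fun z => (z == x) || (z == y)).
    by exists x; rewrite unfold_in eqxx.
  have refl z : W z z.
    by have [|m' -> /(_ z erefl)] := minW [set z]; first by exists z.
  rewrite -(mU x) ?(mU y)//; split; rewrite ?unfold_in ?eqxx ?orbT//.
    by move=> z; rewrite unfold_in => /orP[]/eqP->.
  by move=> z; rewrite unfold_in => /orP[]/eqP->.
have tot x y : W x y \/ W y x.
  have [|m [->|->] mP] := minW [set x; y]; first by exists x; left.
    by left; apply: mP; right.
  by right; apply: mP; left.
have trans x y z : W x y -> W y z -> W x z.
  move=> xy yz; have [|m mxyz mP] := minW [set t | [\/ t = x, t = y | t = z]].
    by exists x; constructor 1.
  have mx := mP x (Or31 _ _ erefl); have my := mP y (Or32 _ _ erefl).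
  have mz := mP z (Or33 _ _ erefl).
  case: mxyz => E; subst m => //.
    by rewrite (anti x y xy mx).
  by rewrite -(anti y z yz my).
pose lt x y := W x y /\ x <> y.
have ltwf : well_founded lt.
  move=> x; apply: contrapT => nx.
  have [|m nm mP] := minW [set x | ~ Acc lt x]; first by exists x.
  apply: nm; constructor => y [ym ne]; apply: contrapT => ny.
  by apply: ne; apply: anti => //; exact: mP.
have lttot x y : [\/ lt x y, x = y | lt y x].
  have [->|/eqP ne] := eqVneq x y; first by constructor 2.
  have [xy|yx] := tot x y; first by constructor 1.
  by constructor 3; split=> // /esym.
pose A := [set x | countable [set y | lt y x]].
exists (set nat), lt, A; split => //.
  move=> x y z [xy xny] [yz ynz]; split; first exact: trans yz.
  by move=> xz; apply: xny; apply: anti => //; rewrite xz.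
(* Were [A] countable, it would miss some element; the least such [m] has all its predecessors in
   [A], hence countably many, so [m] would lie in [A]. *)
move=> cA; have [|m nm mP] := minW (~` A).
  apply: contrapT => H; apply: uncountable_powerset_nat.
  suff -> : [set: set nat] = A by [].
  by apply/seteqP; split=> // x _; apply: contrapT => nAx; apply: H; exists x.
apply: nm; rewrite /A/=; apply: sub_countable cA; apply: subset_card_le.
move=> y [ym ynm]; apply: contrapT => nAy; apply: ynm.
by apply: anti => //; exact: mP.
Qed.

Lemma wf_recursion (T V : Type) (lt : T -> T -> Prop) (step : set V -> V) :
  well_founded lt -> exists t : T -> V, forall x, t x = step (t @` [set y | lt y x]).
Proof.
move=> wf.
pose G x (r : forall y, lt y x -> V) := step [set v | exists y h, r y h = v].
exists (Fix wf (fun=> V) G) => x; rewrite Fix_eq.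
  by congr step; apply/seteqP; split=> v; [move=> [y [h <-]]; exists y|
    move=> [y h <-]; exists y, h].
move=> {}x f g fg; congr step; apply/seteqP; split=> v [y [h <-]].
  by exists y, h; rewrite fg.
by exists y, h; rewrite fg.
Qed.

(** * Continuous functions on powers depend on countably many functions *)

Definition countably_determined (R : realType) (X W : topologicalType)
    (F : X * W -> R) := exists A : set (X -> R),
  [/\ countable A, forall a, A a -> continuous a &
    forall x x', (forall a, A a -> a x = a x') -> forall w, F (x, w) = F (x', w)].

(* Grothendieck's double limit argument: the pattern [k <= n] versus [n < k]
   cannot occur for a jointly continuous function on a pseudocompact square. *)
Lemma double_limit (R : realType) (X : topologicalType) (E : X * X -> R)
    (x x' z : nat -> X) (e : R) :
  completely_regular_space X -> pseudocompact R X -> continuous E -> 0 < e ->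
  (forall n k, (n < k)%N -> E (x k, z n) = E (x' k, z n)) ->
  (forall n k, (k <= n)%N -> e <= `|E (x k, z n) - E (x' k, z n)|) -> False.
Proof.
move=> crX pcX cE e0 Elt Ege.
have [U [UU subU]] := @ultraFilterLemma _ \oo _.
have cEr t : continuous (fun y => E (y, t)).
  move=> y; apply: (@continuous_comp _ _ _ (fun y => (y, t)) E); last exact: cE.
  by apply: cvg_pair; [exact: cvg_id|exact: cvg_cst].
have cEl y : continuous (fun t => E (y, t)).
  move=> t; apply: (@continuous_comp _ _ _ (fun t => (y, t)) E); last exact: cE.
  by apply: cvg_pair; [exact: cvg_cst|exact: cvg_id].
have Hq y : exists l : R, E (y, z n) @[n --> U] --> l.
  have [M _ HM] := bounded_funE (pcX _ (cEl y)).
  by apply: (@ultra_cvg R U (fun n => E (y, z n)) M).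
have [q qE] := choice Hq.
have cq := limit_continuity crX pcX cE _ qE.
(* The limit function [q] is put at index 0 and the section at [z n] at index [n.+1], so that one
   point [y] serves for all of them. *)
pose g n := if n is n'.+1 then fun y => E (y, z n') else q.
have cg n : continuous (g n) by case: n => [|n]; [exact: cq|exact: cEr].
have [y Hy] := pseudocompact_ultra_cvg x pcX UU cg.
have [y' Hy'] := pseudocompact_ultra_cvg x' pcX UU cg.
(* Letting [k] tend first, [y] and [y'] agree at every [z n], hence under [q]; letting [n] tend
   first, they stay at least [e] apart under [q]. *)
have Ey n : E (y, z n) = E (y', z n).
  have H1 := Hy n.+1; have H2 := Hy' n.+1.
  apply: (cvg_unique (@Rhausdorff R) H1); apply: cvg_trans H2; apply: near_eq_cvg.
  by apply: subU; exists n.+1 => // k /= /Elt ->.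
have qy : q y = q y'.
  apply: (cvg_unique (@Rhausdorff R) (qE y)).
  by apply: cvg_trans (qE y'); apply: near_eq_cvg; apply: nearW => n /=; rewrite Ey.
have qx k : e <= `|q (x k) - q (x' k)|.
  apply: (@cvg_lbound R nat U (fun n => `|E (x k, z n) - E (x' k, z n)|)).
    by apply: cvg_norm; apply: cvgB; exact: qE.
  by apply: subU; exists k => // n /=; exact: Ege.
have : e <= `|q y - q y'|.
  apply: (@cvg_lbound R nat U (fun k => `|q (x k) - q (x' k)|)).
    by apply: cvg_norm; apply: cvgB; [exact: (Hy 0)|exact: (Hy' 0)].
  by apply: subU; exists 0 => // k _; exact: qx.
by rewrite qy subrr normr0 leNgt e0.
Qed.

Section determined_step.
Variables (R : realType) (X W : topologicalType).
Hypotheses (crX : completely_regular_space X) (pcX : pseudocompact R X).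
Hypotheses (sX : spread X) (sW : spread W).
Hypothesis IH : forall F : X * W -> R, continuous F -> countably_determined F.
Variables (F : X * (W * X) -> R).
Hypothesis cF : continuous F.

Let cFw x : continuous (fun p : W * X => F (x, p)).
Proof.
have c1 : continuous (fun p : W * X => (x, p)).
  by apply: continuous_pair; [exact: continuous_cst|move=> p; exact: cvg_id].
by move=> p; apply: (@continuous_comp _ _ _ _ F); [exact: c1|exact: cF].
Qed.

Let cFz z : continuous (fun p : X * W => F (p.1, (p.2, z))).
Proof.
have c1 : continuous (fun p : X * W => (p.1, (p.2, z))).
  exact: (continuous_pair (@continuous_fst _ _)
    (continuous_pair (@continuous_snd _ _) (@continuous_cst _ _ z))).
by move=> p; apply: (@continuous_comp _ _ _ _ F); [exact: c1|exact: cF].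
Qed.

Record split_witness := SplitWitness {
  sw_x : X; sw_x' : X; sw_V : set W; sw_H : set X }.

(** The margin [e] is required on the closures because [spread] yields only points of closures. *)
Definition splits (e : R) (D : set X) (t : split_witness) :=
  [/\ forall d w, D d -> F (sw_x t, (w, d)) = F (sw_x' t, (w, d)),
    open (sw_V t) /\ sw_V t !=set0, open (sw_H t) /\ sw_H t !=set0 &
    forall w z, closure (sw_V t) w -> closure (sw_H t) z ->
      e <= `|F (sw_x t, (w, z)) - F (sw_x' t, (w, z))|].

(** If each margin [m.+1%:R^-1] had a countable [D m] without a witness, the functions given by [IH]
    for the last coordinates in all the [D m] would determine [F]: two points agreeing on them but
    not under [F] differ by some margin on a small box, which gives a witness. *)
Lemma splits_exists : ~ countably_determined F ->
  exists2 e : R, 0 < e & forall D, countable D -> exists t, splits e D t.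
Proof.
move=> nF.
have [A HA] := choice (fun z => IH (@cFz z)).
apply: contrapT => H.
have {}H (m : nat) : exists D : set X, countable D /\
    ~ exists t, splits m.+1%:R^-1 D t.
  apply: contrapT => Hm; apply: H; exists m.+1%:R^-1; first by rewrite invr_gt0.
  by move=> D cD; apply: contrapT => Ht; apply: Hm; exists D.
have [D HD] := choice H.
apply: nF; exists (\bigcup_m \bigcup_(d in D m) A d); split.
- apply: bigcup_countable => // m _; apply: bigcup_countable; first exact: (HD m).1.
  by move=> d _; have [] := HA d.
- by move=> a [m _ [d _ Ada]]; have [_ + _] := HA d; apply.
move=> x x' xx' [w z]; apply/eqP; rewrite -subr_eq0 -normr_eq0.
apply/negPn/negP => /eqP ne.
have pos : 0 < `|F (x, (w, z)) - F (x', (w, z))|.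
  by rewrite lt_neqAle normr_ge0 andbT eq_sym; apply/eqP.
have [m _ Hm] := near_infty_natSinv_lt (PosNum pos).
have {}Hm := Hm m (leqnn m); apply: (HD m).2.
pose N p := `|F (x, p) - F (x', p)|.
have cN : continuous N by move=> p; apply: cvg_norm; apply: cvgB; exact: cFw.
have [] : nbhs (w, z) [set p | m.+1%:R^-1 < N p].
  apply: (cN (w, z) [set r | m.+1%:R^-1 < r]); apply: open_nbhs_nbhs.
  by split; [exact: open_gt|exact: Hm].
move=> [V G] /= [nV nG] VG; exists (SplitWitness x x' V^° G^°); split => /=.
- move=> d w' Dd; have [_ _ H3] := HA d; apply: (H3 x x') => a Ada.
  by apply: xx'; exists m => //; exists d.
- by split; [exact: open_interior|exists w; exact: nbhs_singleton (nbhs_interior nV)].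
- by split; [exact: open_interior|exists z; exact: nbhs_singleton (nbhs_interior nG)].
move=> w' z' clV clG; rewrite leNgt; apply/negP => lt.
have [] : nbhs (w', z') [set p | N p < m.+1%:R^-1].
  apply: (cN (w', z') [set r | r < m.+1%:R^-1]); apply: open_nbhs_nbhs.
  by split; [exact: open_lt|exact: lt].
move=> [P Q] /= [nP nQ] PQ.
have [w1 [/interior_subset Vw1 Pw1]] := clV _ nP.
have [z1 [/interior_subset Gz1 Qz1]] := clG _ nQ.
have /= h1 := PQ (w1, z1) (conj Pw1 Qz1); have /= h2 := VG (w1, z1) (conj Vw1 Gz1).
by have := lt_trans h1 h2; rewrite ltxx.
Qed.

(* A transfinite sequence of witnesses, each splitting only points that agree
   over a countable set anticipating all finite intersections of the earlier
   [sw_H]; a sequence in an uncountable subfamily with nonempty intersections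
   then exhibits the pattern excluded by [double_limit]. *)
Lemma determined_step : countably_determined F.
Proof.
apply: contrapT => /splits_exists[e e0 He].
have [T [lt [S [wf ltT lttot nS cS]]]] := omega1_exists.
have [t00 _] := He _ (countable0 X).
have Hstep D : exists t, countable D -> splits e D t.
  by have [/He[t ht]|?] := pselect (countable D); [exists t|exists t00].
have [step stepP] := choice Hstep.
(* The common point depends only on the set of witnesses, so that [D] can contain it before the
   sequence [s] is known. *)
have Hc (Q : set split_witness) : exists z : X, (exists z', forall t, Q t ->
    closure (sw_H t) z') -> forall t, Q t -> closure (sw_H t) z.
  have [[z Hz]|nz] := pselect (exists z', forall t, Q t -> closure (sw_H t) z').
    by exists z.
  by exists (sw_x t00) => z; exfalso; exact: nz.
have [c cP] := choice Hc.
pose D (Q : set split_witness) := c @` [set A | A `<=` Q /\ finite_set A].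
have cD Q : countable Q -> countable (D Q).
  move=> cQ; apply: sub_countable (card_image_le _ _) _.
  exact: countable_finite_subset.
have [t tE] := wf_recursion (fun Q => step (D Q)) wf.
have tP x : S x -> splits e (D (t @` [set y | lt y x])) (t x).
  move=> Sx; rewrite tE; apply: stepP; apply: cD.
  by apply: sub_countable (card_image_le _ _) (cS x Sx).
have [|S1 [S1S nS1 HS1]] := @sW T S (fun x => sw_V (t x)) nS.
  by move=> x /tP[].
have [|S2 [S2S nS2 HS2]] := @sX T S1 (fun x => sw_H (t x)) nS1.
  by move=> x /S1S/tP[].
(* The uncountable [S2] is not contained in the countable set of indices up to [x]; this yields an
   increasing sequence in [S2]. *)
have Hnext x : exists y, S x -> S2 y /\ lt x y.
  have [Sx|nSx] := pselect (S x); last by exists x.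
  apply: contrapT => H; apply: nS2.
  suff : S2 `<=` \bigcup_(b in [set: bool]) (if b then [set y | lt y x] else [set x]).
    move=> sub; apply: sub_countable (subset_card_le sub) _.
    apply: bigcup_countable; first exact: countableP.
    by move=> [] _; [exact: cS|exact: countable1].
  move=> y S2y; have [xy|<-|yx] := lttot x y; [|by exists false|by exists true].
  by exfalso; apply: H; exists y.
have [next nextP] := choice Hnext.
have [s0 S2s0] : S2 !=set0.
  by apply/set0P/negP => /eqP S20; apply: nS2; rewrite S20; exact: countable0.
pose s k := iter k next s0.
have S2s k : S2 (s k).
  by elim: k => // k IHk; have [] := nextP (s k) (S1S _ (S2S _ IHk)).
have Ss k : S (s k) by exact/S1S/S2S.
have slt i k : (i < k)%N -> lt (s i) (s k).
  elim: k => // k IHk; rewrite ltnS leq_eqVlt => /predU1P[->|/IHk h].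
    by have [] := nextP (s k) (Ss k).
  by apply: ltT h _; have [] := nextP (s k) (Ss k).
have [w Hw] := HS1 s (fun k => S2S _ (S2s k)).
have [z0 Hz0] := HS2 s S2s.
(* [z n] lies in the closures of [sw_H] for the first [n.+1] witnesses of the sequence, and in the
   set [D] of every later one. *)
pose Q n := (t \o s) @` `I_n.+1.
pose z n := c (Q n).
have zH n k : (k <= n)%N -> closure (sw_H (t (s k))) (z n).
  move=> kn; apply: cP; last by exists k.
  by exists z0 => _ [i _ <-]; exact: Hz0.
have zD n k : (n < k)%N -> D (t @` [set y | lt y (s k)]) (z n).
  move=> nk; exists (Q n) => //; split; last by apply: finite_image; exact: finite_II.
  move=> _ [i /= ilt <-]; exists (s i) => //=; apply: slt.
  by rewrite (leq_trans _ nk).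
apply: (@double_limit R X (fun p => F (p.1, (w, p.2))) (fun k => sw_x (t (s k)))
  (fun k => sw_x' (t (s k))) z e) => //.
- have c1 : continuous (fun p : X * X => (p.1, (w, p.2))).
    exact: (continuous_pair (@continuous_fst _ _)
      (continuous_pair (@continuous_cst _ _ w) (@continuous_snd _ _))).
  by move=> p; apply: (@continuous_comp _ _ _ _ F); [exact: c1|exact: cF].
- by move=> n k nk /=; have [+ _ _ _] := tP _ (Ss k); apply; exact: zD.
- by move=> n k kn /=; have [_ _ _] := tP _ (Ss k); apply; [exact: Hw|exact: zH].
Qed.

End determined_step.

(** * Finite powers and symmetric functions of finite sequences *)

Definition point_space : topologicalType := initial_topology (fun _ : unit => 0%N).

(** The new factor stands on the right, which gives [X * power X m.+1] the shape [X * (W * X)] of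
    [determined_step]. *)
Fixpoint power (X : topologicalType) (m : nat) : topologicalType :=
  if m is m'.+1 then (power X m' * X)%type else point_space.

Fixpoint power_seq (X : topologicalType) (m : nat) : power X m -> seq X :=
  if m is m'.+1 return power X m -> seq X
  then fun p => p.2 :: power_seq p.1 else fun=> [::].

Lemma power_seq_surj (X : topologicalType) (s : seq X) :
  exists w : power X (size s), power_seq w = s.
Proof.
elim: s => [|x s [w ws]]; first by exists tt.
by exists (w, x); rewrite /= ws.
Qed.

Section determined_power.
Variables (R : realType) (X : topologicalType).
Hypotheses (crX : completely_regular_space X) (pcX : pseudocompact R X).
Hypothesis preX : precaliber_omega1 X.

Lemma spread_power m : spread (power X m).
Proof.
have sX := spread_pseudocompact crX pcX preX.
elim: m => [|m IH]; last exact: spread_prod.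
by apply: spread_subsingleton => -[] [].
Qed.

Lemma determined_power m (F : X * power X m -> R) :
  continuous F -> countably_determined F.
Proof.
have sX := spread_pseudocompact crX pcX preX.
elim: m F => [|m IH] F cF; last first.
  exact: (determined_step crX pcX sX (@spread_power m) IH cF).
exists [set (fun x => F (x, tt))]; split.
- exact: countable1.
- have c1 : continuous (fun x : X => (x, tt : point_space)).
    by apply: continuous_pair; [move=> x; exact: cvg_id|exact: continuous_cst].
  by move=> _ -> x; apply: (@continuous_comp _ _ _ _ F); [exact: c1|exact: cF].
- by move=> x x' /(_ _ erefl) xx' [].
Qed.

(** Entries are replaced one at a time: symmetry moves the entry in question to the front, where
    [determined_power] applies. *)
Lemma determined_seq (f : seq X -> R) :
  (forall s s', perm_eq s s' -> f s = f s') ->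
  (forall m, continuous (fun p : X * power X m => f (p.1 :: power_seq p.2))) ->
  exists A : set (X -> R), [/\ countable A, forall a, A a -> continuous a &
    forall ps : seq (X * X),
      (forall p, p \in ps -> forall a, A a -> a p.1 = a p.2) ->
      f (map fst ps) = f (map snd ps)].
Proof.
move=> fperm cf; have [A HA] := choice (fun m => determined_power (cf m)).
exists (\bigcup_m A m); split.
- by apply: bigcup_countable => // m _; have [] := HA m.
- by move=> a [m _]; have [_ + _] := HA m; apply.
(* [u] is the prefix of the entries already replaced. *)
suff H ps u : (forall p, p \in ps -> forall a, (\bigcup_m A m) a -> a p.1 = a p.2) ->
    f (u ++ map fst ps) = f (u ++ map snd ps) by move=> ps /(H ps [::]).
elim: ps u => [//|[x x'] ps IH] u Hps /=.
have -> : f (u ++ x :: map fst ps) = f (u ++ x' :: map fst ps).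
  have [w we] := power_seq_surj (u ++ map fst ps).
  rewrite (fperm _ (x :: u ++ map fst ps)); last first.
    by apply/permPl; exact: (perm_catCA u [:: x] _).
  rewrite (fperm (u ++ x' :: map fst ps) (x' :: u ++ map fst ps)); last first.
    by apply/permPl; exact: (perm_catCA u [:: x'] _).
  rewrite -we; have [_ _ H] := HA (size (u ++ map fst ps)).
  apply: (H x x') => a Aa; apply: (Hps (x, x')); first by rewrite mem_head.
  by exists (size (u ++ map fst ps)).
rewrite -2!cat_rcons; apply: IH => p pps; apply: Hps.
by rewrite in_cons pps orbT.
Qed.

End determined_power.

(** * Integration against Radon probabilities *)

Section borel_integral.
Variables (R : realType) (Z : topologicalType).

Lemma borel_measurable_fun (h : inhabited Z) (g : Z -> R) : continuous g ->
  measurable_fun [set: borel h] (g : borel h -> R).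
Proof.
move=> cg; apply: (measurability _ (RGenOInfty.measurableE R)).
move=> _ [_ [x ->] <-]; rewrite setTI; apply: sub_sigma_algebra.
apply: (@open_comp _ _ g); first by move=> y _; exact: cg.
by rewrite set_itvE; exact: open_gt.
Qed.

Lemma borel_integrable (mu : radon_prob R Z) (g : Z -> R) : continuous g ->
  bounded_fun g -> (rp_mu mu).-integrable setT (EFin \o (g : borel (rp_inh mu) -> R)).
Proof.
move=> cg bg; apply: measurable_bounded_integrable => //.
- apply: (@le_lt_trans _ _ 1%E); last exact: ltry.
  by rewrite le_eqVlt; apply/orP; left; apply/eqP; exact: probability_setT.
- exact: borel_measurable_fun.
Qed.

Lemma rp_int_cst (mu : radon_prob R Z) (c : R) : rp_int (fun=> c) mu = c.
Proof. rewrite /rp_int Rintegral_cst//; transitivity (c * fine 1%E); last exact: mulr1.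
by congr (_ * fine _); exact: probability_setT. Qed.

Lemma rp_int_le (mu : radon_prob R Z) (f g : Z -> R) :
  continuous f -> bounded_fun f -> continuous g -> bounded_fun g ->
  (forall x, f x <= g x) -> rp_int f mu <= rp_int g mu.
Proof.
move=> cf bf cg bg fg; apply: le_Rintegral => //; exact: borel_integrable.
Qed.

Lemma rp_intD (mu : radon_prob R Z) (f g : Z -> R) :
  continuous f -> bounded_fun f -> continuous g -> bounded_fun g ->
  rp_int (fun x => f x + g x) mu = rp_int f mu + rp_int g mu.
Proof.
by move=> cf bf cg bg; apply: RintegralD => //; exact: borel_integrable.
Qed.

Lemma rp_intB (mu : radon_prob R Z) (f g : Z -> R) :
  continuous f -> bounded_fun f -> continuous g -> bounded_fun g ->
  rp_int (fun x => f x - g x) mu = rp_int f mu - rp_int g mu.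
Proof.
by move=> cf bf cg bg; apply: RintegralB => //; exact: borel_integrable.
Qed.

Lemma rp_intZ (mu : radon_prob R Z) (f : Z -> R) (c : R) :
  continuous f -> bounded_fun f ->
  rp_int (fun x => c * f x) mu = c * rp_int f mu.
Proof. by move=> cf bf; apply: RintegralZl => //; exact: borel_integrable. Qed.

End borel_integral.

(* [radon_prob] requires the value 0 on nonmeasurable sets. *)
Section trim.
Context d (T : measurableType d) (R : realType) (m : {measure set T -> \bar R}).
Local Open Scope ereal_scope.

Definition trim (B : set T) : \bar R := if `[< measurable B >] then m B else 0.

Lemma trimE B : measurable B -> trim B = m B.
Proof. by move=> /asboolP; rewrite /trim => ->. Qed.

Let trim0 : trim set0 = 0.
Proof. by rewrite trimE. Qed.

Let trim_ge0 B : 0 <= trim B.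
Proof. by rewrite /trim; case: ifP. Qed.

Let trim_sigma_additive : semi_sigma_additive trim.
Proof.
move=> F mF tF mU; rewrite (trimE mU).
under eq_fun do under eq_bigr do rewrite (trimE (mF _)).
exact: measure_semi_sigma_additive.
Qed.

HB.instance Definition _ := isMeasure.Build _ _ _ trim trim0 trim_ge0 trim_sigma_additive.

Hypothesis m1 : m setT = 1.

Let trim_setT : trim setT = 1.
Proof. by rewrite trimE. Qed.

Definition trim_prob of m setT = 1 := trim.

HB.instance Definition _ := Measure.copy (trim_prob m1) trim.
HB.instance Definition _ :=
  Measure_isProbability.Build _ _ _ (trim_prob m1) trim_setT.

End trim.

(** * Averages of Dirac measures *)

Section average.
Variables (R : realType) (Z : topologicalType) (h : inhabited Z).
Variables (n : nat) (k : nat -> Z).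

Let T := borel h.

Definition average : {measure set T -> \bar R} :=
  mscale (n.+1%:R^-1)%:nng (msum (fun i => \d_(k i : T)) n.+1).

Lemma averageE (B : set T) :
  average B = (\sum_(i < n.+1) (n.+1%:R^-1)%:E * \d_(k i : T) B)%E.
Proof. by rewrite /= /mscale /= /msum ge0_sume_distrr. Qed.

Lemma average_setT : average setT = 1%E.
Proof.
rewrite averageE; under eq_bigr do rewrite diracT mule1.
by rewrite sumEFin sumr_const card_ord -[_ *+ _]mulr_natl divff.
Qed.

Lemma radon_average : radon (trim_prob average_setT).
Proof.
move=> B mB e e0; exists (B `&` k @` `I_n.+1); split.
- apply: finite_compact; apply: finite_setIr; apply: finite_image; exact: finite_II.
- by move=> x [].
apply: (@le_lt_trans _ _ 0%E); last by rewrite lte_fin.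
rewrite le_eqVlt; apply/orP; left; apply/eqP; rewrite /= /trim_prob /trim.
case: ifP => // _; rewrite averageE big1// => i _.
rewrite diracE memNset ?mule0// => -[Bk]; apply; split=> //.
by exists i => //=.
Qed.

Lemma average_junk (B : set T) : ~ measurable B -> trim_prob average_setT B = 0%E.
Proof. by move=> nB; rewrite /= /trim_prob /trim; case: ifP => // /asboolP. Qed.

(** The integration formulas for scaled measures and finite sums of measures cover nonnegative
    functions; the general case follows by adding a bound [M] of [g]. *)
Lemma average_integral (g : Z -> R) : continuous g -> bounded_fun g ->
  \int[trim_prob average_setT]_x (g : T -> R) x = n.+1%:R^-1 * \sum_(i < n.+1) g (k i).
Proof.
move=> cg bg; have mg := borel_measurable_fun (h := h) cg.
have [M M0 HM] := bounded_funE bg.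
have ge0 (f : Z -> R) : continuous f -> (forall x, 0 <= f x) ->
    (\int[trim_prob average_setT]_x ((f : T -> R) x)%:E =
    (n.+1%:R^-1 * \sum_(i < n.+1) f (k i))%:E)%E.
  move=> cf f0; have mf := borel_measurable_fun (h := h) cf.
  rewrite (@eq_measure_integral _ _ _ _ average); last first.
    by move=> A mA _; rewrite /= /trim_prob trimE.
  rewrite ge0_integral_mscale//; last 2 first.
  - exact/measurable_EFinP.
  - by move=> x _; rewrite lee_fin.
  rewrite ge0_integral_measure_sum//; last 2 first.
  - by move=> x _; rewrite lee_fin.
  - exact/measurable_EFinP.
  rewrite EFinM -sumEFin; congr (_ * _)%E; apply: eq_bigr => i _.
  rewrite integral_dirac//; last exact/measurable_EFinP.
  by rewrite diracT mul1e.
have igM : (trim_prob average_setT).-integrable setT (EFin \o (fun x : T => g x + M)).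
  apply: measurable_bounded_integrable => //.
  - apply: (@le_lt_trans _ _ 1%E); last exact: ltry.
    by rewrite le_eqVlt; apply/orP; left; apply/eqP; exact: probability_setT.
  - by apply: measurable_funD => //; exact: measurable_cst.
  - apply: (@bounded_funI _ _ _ (M + M)) => x.
    by rewrite (le_trans (ler_normD _ _))// lerD// ger0_norm// ltW.
have iM : (trim_prob average_setT).-integrable setT (EFin \o (fun _ : T => M)).
  apply: measurable_bounded_integrable => //.
  - apply: (@le_lt_trans _ _ 1%E); last exact: ltry.
    by rewrite le_eqVlt; apply/orP; left; apply/eqP; exact: probability_setT.
  - by apply: (@bounded_funI _ _ _ `|M|).
have -> : \int[trim_prob average_setT]_x (g : T -> R) x =
    \int[trim_prob average_setT]_x ((g x + M) - M).
  by apply: eq_Rintegral => x _; rewrite addrK.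
rewrite RintegralB//.
have -> : \int[trim_prob average_setT]_(_ in [set: T]) M = M.
  rewrite Rintegral_cst//; transitivity (M * fine 1%E); last exact: mulr1.
  by congr (_ * fine _); exact: probability_setT.
rewrite /Rintegral (ge0 (fun x => g x + M)) /=.
- rewrite big_split/= mulrDr sumr_const card_ord -[M *+ _]mulr_natl mulKf ?pnatr_eq0//.
  by rewrite addrK.
- by move=> x; apply: cvgD; [exact: cg|exact: cvg_cst].
- by move=> x; have := HM x; rewrite ler_norml => /andP[+ _] => ?; lra.
Qed.

End average.

(** The values on Borel sets identify the measure, so that permuted sequences will have equal
    averages; the integrals serve for weak limits. *)
Lemma average_exists (R : realType) (X : topologicalType) (s : seq X) :
  (0 < size s)%N ->
  exists mu : radon_prob R (beta R X), [/\ fin_supp_prob R X mu,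
    (forall B : set (beta R X), <<s open >> B -> rp_mu mu B =
       (\sum_(x <- s) ((size s)%:R^-1)%:E * ((beta_in R x \in B)%:R)%:E)%E) &
    (forall g : beta R X -> R, continuous g -> bounded_fun g ->
       rp_int g mu = (size s)%:R^-1 * \sum_(x <- s) g (beta_in R x))].
Proof.
case: s => // x0 s _; set xs := x0 :: s.
have h : inhabited (beta R X) by exists; exact: (beta_in R x0).
pose k i := beta_in R (nth x0 xs i).
exists (RadonProb (@radon_average R _ h (size s) k) (@average_junk R _ h (size s) k)).
split.
- exists (size s).+1, (fun i => nth x0 xs i), (fun=> (size s).+1%:R^-1); split.
  + by move=> i; rewrite invr_ge0.
  + by rewrite sumr_const card_ord -[_ *+ _]mulr_natl divff.
  + by move=> B mB; rewrite /= /trim_prob trimE// averageE.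
- move=> B mB; rewrite /= /trim_prob trimE// averageE.
  rewrite (big_nth x0) big_mkord; apply: eq_bigr => i _.
  by rewrite diracE.
- move=> g cg bg; rewrite /rp_int /= average_integral//.
  by rewrite [in RHS](big_nth x0) big_mkord.
Qed.

(** * Countable lattices of functions on a compact space *)

(** The sets whose complement satisfies [P] form a filter; if [P setT] failed it would be proper,
    and a cluster point of it would contradict the local hypothesis. *)
Lemma compact_induction (K : topologicalType) (P : set K -> Prop) :
  compact [set: K] -> P set0 -> (forall A B, A `<=` B -> P B -> P A) ->
  (forall A B, P A -> P B -> P (A `|` B)) ->
  (forall p : K, exists2 N : set K, nbhs p N & P N) -> P setT.
Proof.
move=> cK P0 Psub PU Ploc; apply: contrapT => nPT.
pose F : set_system K := [set A | P (~` A)].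
have FF : ProperFilter F.
  apply: Build_ProperFilter_ex => [A FA|].
    apply: contrapT => A0; apply: nPT; apply: Psub FA => x _ Ax.
    by apply: A0; exists x.
  split.
  - by rewrite /F/= setCT.
  - by move=> A B FA FB; rewrite /F/= setCI; exact: PU.
  - by move=> A B AB; apply: Psub; exact: subsetC.
have [p [_ clp]] := cK F FF (filterT).
have [N pN PN] := Ploc p.
have [|x [nNx Nx]] := clp (~` N) N _ pN; first by rewrite /F/= setCK.
exact: nNx.
Qed.

Lemma nbhs_lt_continuous (R : realType) (K : topologicalType) (f g : K -> R) (p : K) :
  continuous f -> continuous g -> f p < g p -> nbhs p [set q | f q < g q].
Proof.
move=> cf cg fg; have cfg : continuous (fun q => g q - f q).
  by move=> q; apply: cvgB; [exact: cg|exact: cf].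
have : nbhs p [set q | 0 < g q - f q].
  apply: (cfg p [set r | 0 < r]); apply: open_nbhs_nbhs; split.
    exact: open_gt.
  by rewrite /= subr_gt0.
by apply: filterS => q /=; rewrite subr_gt0.
Qed.

Lemma compact_bounded_fun (R : realType) (K : topologicalType) (f : K -> R) :
  compact [set: K] -> continuous f -> bounded_fun f.
Proof.
move=> cK cf.
suff [M HM] : exists M, forall p, [set: K] p -> `|f p| <= M.
  by apply: (@bounded_funI _ _ _ M) => p; exact: HM.
apply: (@compact_induction K (fun A => exists M, forall p, A p -> `|f p| <= M) cK).
- by exists 0.
- by move=> A B AB [M HM]; exists M => p /AB; exact: HM.
- move=> A B [M HM] [N HN]; exists (Num.max M N) => p [/HM|/HN] h.
    by rewrite le_max h.
  by rewrite le_max h orbT.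
- move=> p; have cn : continuous (fun q => `|f q|).
    by move=> q; apply: cvg_norm; exact: cf.
  exists [set q | `|f q| < `|f p| + 1]; last by exists (`|f p| + 1) => q /ltW.
  apply: (@nbhs_lt_continuous R K (fun q => `|f q|) (fun=> `|f p| + 1)) => //.
  - exact: continuous_cst.
  - by rewrite ltrDl.
Qed.

(** The compactness argument of the Stone-Weierstrass theorem, used twice: finite maxima give a
    function above [g] everywhere and below [v] at a given [p'], then finite minima bring it below
    [v] everywhere. *)
Lemma lattice_insertion (R : realType) (K : topologicalType) (L : set (K -> R))
    (g v : K -> R) (p0 : K) :
  compact [set: K] -> (forall l, L l -> continuous l) ->
  (forall l m, L l -> L m -> L (l \max m)) ->
  (forall l m, L l -> L m -> L (l \min m)) ->
  continuous g -> continuous v ->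
  (forall p p', exists2 l, L l & g p < l p /\ l p' < v p') ->
  exists2 l, L l & forall p, g p < l p /\ l p < v p.
Proof.
move=> cK cL Lmax Lmin cg cv sep.
have H p' : exists2 l, L l & (forall p, setT p -> g p < l p) /\ l p' < v p'.
  apply: (@compact_induction K (fun A => exists2 l, L l &
    (forall p, A p -> g p < l p) /\ l p' < v p') cK).
  - by have [l Ll [_ lv]] := sep p0 p'; exists l.
  - by move=> A B AB [l Ll [lB lv]]; exists l => //; split=> // p /AB; exact: lB.
  - move=> A B [l Ll [lA lv]] [m Lm [mB mv]]; exists (l \max m); first exact: Lmax.
    split; last by rewrite /= gt_max lv.
    by move=> p [/lA|/mB] h; rewrite /= lt_max h ?orbT.
  - move=> p; have [l Ll [gl lv]] := sep p p'.
    by exists [set q | g q < l q]; [apply: nbhs_lt_continuous => //; exact: cL|exists l].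
suff [l Ll Hl] : exists2 l, L l & (forall p, g p < l p) /\ forall p, setT p -> l p < v p.
  by exists l => // p; split; [exact: Hl.1|exact: Hl.2].
apply: (@compact_induction K (fun A => exists2 l, L l &
    (forall p, g p < l p) /\ forall p, A p -> l p < v p) cK).
- by have [l Ll [gl _]] := H p0; exists l => //; split=> // p; exact: gl.
- by move=> A B AB [l Ll [gl lB]]; exists l => //; split=> // p /AB; exact: lB.
- move=> A B [l Ll [gl lA]] [m Lm [gm mB]]; exists (l \min m); first exact: Lmin.
  split=> p; first by rewrite /= lt_min gl gm.
  by move=> [/lA|/mB] h; rewrite /= gt_min h ?orbT.
- move=> p; have [l Ll [gl lv]] := H p; exists [set q | l q < v q].
    by apply: nbhs_lt_continuous => //; exact: cL.
  by exists l => //; split=> // q; exact: gl.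
Qed.

Lemma countable_enum (T : Type) (S : set T) (x0 : T) : countable S -> S x0 ->
  exists f : nat -> T, range f = S.
Proof.
move=> /countable_injP[h hI] Sx0.
have H n : exists x, S x /\ forall y, S y -> h y = n -> y = x.
  have [[y Sy hy]|nH] := pselect (exists2 y, S y & h y = n).
    exists y; split=> // y' Sy' hy'; apply: hI; [exact: mem_set|exact: mem_set|].
    by rewrite hy hy'.
  by exists x0; split=> // y Sy hy; exfalso; apply: nH; exists y.
have [f Hf] := choice H; exists f; apply/seteqP; split=> [_ [n _ <-]|x Sx].
  by have [] := Hf n.
by exists (h x) => //; apply/esym; apply: (Hf (h x)).2.
Qed.

Section countable_lattice.
Variables (R : realType) (K : topologicalType) (A : set (K -> R)).
Hypotheses (cA : countable A) (contA : forall a, A a -> continuous a).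

(** Integer multiples enlarge a difference of values of [a] beyond any bound, rational shifts put it
    in place, and the zero function supplies the rational constants. *)
Let base : set (K -> R) :=
  (fun c : (K -> R) * (int * rat) => fun p => c.2.1%:~R * c.1 p + ratr c.2.2) @`
    ((A `|` [set fun=> 0]) `*` setT).

Let lattice_op (c : (K -> R) * (K -> R) * bool) : K -> R :=
  if c.2 then c.1.1 \max c.1.2 else c.1.1 \min c.1.2.

Let Fixpoint lattice n : set (K -> R) := if n is n'.+1 then
  lattice_op @` ((lattice n' `*` lattice n') `*` setT) else base.

Lemma countable_lattice : exists l : nat -> K -> R,
  [/\ forall n, continuous (l n),
    forall i j, (exists n, l n = l i \max l j) /\ (exists n, l n = l i \min l j) &
    forall p p' u v, u < v \/ (exists2 a, A a & a p <> a p') ->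
      exists n, u < l n p /\ l n p' < v].
Proof.
have cU : countable (\bigcup_n lattice n).
  apply: bigcup_countable => // n _; elim: n => [|n IH].
    apply: sub_countable (card_image_le _ _) _; apply: countableX => //.
    suff : A `|` [set fun=> 0] `<=`
        \bigcup_(b in [set: bool]) if b then A else [set fun=> 0].
      move=> sub; apply: sub_countable (subset_card_le sub) _.
      apply: bigcup_countable; first exact: countableP.
      by move=> [] _ //; exact: countable1.
    by move=> a [Aa|->]; [exists true|exists false].
  apply: sub_countable (card_image_le _ _) _; apply: countableX; last exact: countableP.
  exact: countableX.
have U0 : (\bigcup_n lattice n) (fun p => 0%:~R * 0 + ratr 0).
  exists 0%N => //; exists ((fun=> 0), (0, 0)); last exact: erefl.
  by split; [right; exact: erefl|exact: I].
have [l lE] := countable_enum cU U0.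
have lU n : exists k, lattice k (l n).
  have [k _ kl] : (\bigcup_n lattice n) (l n) by rewrite -lE; exists n.
  by exists k.
have Ul k f : lattice k f -> exists n, l n = f.
  move=> kf; have [n _ <-] : range l f by rewrite lE; exists k.
  by exists n.
have lS k f : lattice k f -> lattice k.+1 f.
  move=> kf; exists (f, f, true) => //.
  by apply/funext => p; rewrite /lattice_op/= maxxx.
have lmono k k' f : (k <= k')%N -> lattice k f -> lattice k' f.
  elim: k' => [|k' IH]; first by rewrite leqn0 => /eqP->.
  by rewrite leq_eqVlt => /predU1P[->//|/IH{}IH /IH]; exact: lS.
exists l; split.
- move=> n; have [k] := lU n; elim: k (l n) => [|k IH] f /=.
    move=> [[a [m q]] /= [Aa _] <-] p; apply: cvgD; last exact: cvg_cst.
    apply: cvgM; first exact: cvg_cst.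
    by case: Aa => [/contA|->]; [apply|exact: cvg_cst].
  move=> [[[f1 f2] b] /= [[/IH c1 /IH c2] _] <-]; rewrite /lattice_op/=.
  by case: b => p; [apply: continuous_max|apply: continuous_min];
    [exact: c1|exact: c2|exact: c1|exact: c2].
- move=> i j; have [k ki] := lU i; have [k' kj] := lU j.
  have {}ki := lmono _ _ _ (leq_maxl k k') ki.
  have {}kj := lmono _ _ _ (leq_maxr k k') kj.
  split; apply: (Ul (maxn k k').+1).
    by exists (l i, l j, true).
  by exists (l i, l j, false).
have aff (a : K -> R) (m : int) p p' u v : (A `|` [set fun=> 0]) a ->
    u - m%:~R * a p < v - m%:~R * a p' -> exists n, u < l n p /\ l n p' < v.
  move=> Aa /rat_in_itvoo[q]; rewrite in_itv/= => /andP[uq qv].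
  have [n ln] : exists n, l n = (fun p => m%:~R * a p + ratr q).
    by apply: (Ul 0%N); exists (a, (m, q)).
  by exists n; rewrite ln; split; lra.
move=> p p' u v [uv|[a Aa ap]].
  by apply: (aff (fun=> 0) 0); [right|rewrite !mulr0 !subr0].
have d0 : 0 < `|a p - a p'| by rewrite normr_gt0 subr_eq0; exact/eqP.
(* The multiplier makes [n] times the distance of [a p] and [a p'] exceed [u - v]; its sign is then
   taken to be that of [a p - a p']. *)
pose n := Num.bound (`|u - v| / `|a p - a p'|).
have nb : `|u - v| < n%:R * `|a p - a p'|.
  by rewrite -ltr_pdivrMr//; apply: archi_boundP; rewrite divr_ge0.
have uv := le_lt_trans (ler_norm _) nb.
have [ge|lt] := leP 0 (a p - a p').
  rewrite ger0_norm// in uv.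
  by apply: (aff a n%:Z); [left|rewrite -pmulrn; lra].
rewrite ltr0_norm// in uv.
by apply: (aff a (- n%:Z)); [left|rewrite mulrNz -pmulrn; lra].
Qed.

End countable_lattice.

(** * Approximation of measures by averages in the same fibres *)

(* Blackwell's approachability: choosing each vector opposite to the current sum
   keeps the squared norm of the sum linear in the number of vectors. *)
Lemma greedy_balance (R : realType) (T : Type) (J : finType) (v : T -> J -> R)
    (M : R) : (forall t j, `|v t j| <= M) ->
  (forall c : J -> R, exists t, -1 <= \sum_j c j * v t j) ->
  forall e : R, 0 < e -> exists s : seq T, (0 < size s)%N /\
    forall j, `|\sum_(t <- s) v t j| <= e * (size s)%:R.
Proof.
move=> vM vc e e0.
have aux (p q r k m : R) : -1 <= p -> q <= k -> r <= m * (k + 2) ->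
    q - 2 * p + r <= (m + 1) * (k + 2) by move=> ? ? ?; lra.
(* Adding [v t] raises the squared norm of the sum by at most [#|J|%:R * M ^+ 2], plus 2 from the
   cross term, as the direction [c] is minus the current sum. *)
pose C : R := #|J|%:R * M ^+ 2 + 2.
have M0 (t : T) (j : J) : 0 <= M by exact: le_trans (normr_ge0 _) (vM t j).
have C0 : 0 <= C by rewrite addr_ge0// mulr_ge0// sqr_ge0.
have step n : exists s : seq T, size s = n /\
    \sum_j (\sum_(t <- s) v t j) ^+ 2 <= n%:R * C.
  elim: n => [|n [s [sn sC]]].
    by exists [::]; split=> //; rewrite mul0r big1// => j _; rewrite big_nil expr0n.
  have [t Ht] := vc (fun j => - \sum_(t <- s) v t j).
  exists (t :: s); split; first by rewrite /= sn.
  have vt : \sum_j v t j ^+ 2 <= #|J|%:R * M ^+ 2.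
    rewrite -sum1_card natr_sum mulr_suml; apply: ler_sum => j _.
    rewrite mul1r -[leLHS]real_normK ?num_real// lerXn2r ?nnegrE//.
    exact: M0 t j.
  have -> : \sum_j (\sum_(t <- t :: s) v t j) ^+ 2 =
     \sum_j v t j ^+ 2 - 2 * \sum_j (- (\sum_(t <- s) v t j)) * v t j +
     \sum_j (\sum_(t <- s) v t j) ^+ 2.
    rewrite mulr_sumr -sumrB -big_split/=; apply: eq_bigr => j _.
    by rewrite big_cons; ring.
  rewrite -[n.+1%:R]natr1 /C; apply: aux; [exact: Ht|exact: vt|exact: sC].
pose n := (Num.bound (C / e ^+ 2)).+1.
have [s [sn sC]] := step n; exists s; rewrite sn; split=> // j.
have n1 : C / e ^+ 2 <= n%:R.
  apply: ltW; apply: lt_le_trans (archi_boundP _) _; first by rewrite divr_ge0// sqr_ge0.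
  by rewrite ler_nat.
rewrite ler_pdivrMr ?exprn_gt0// in n1.
rewrite -ler_sqr ?nnegrE ?normr_ge0 ?mulr_ge0 ?(ltW e0)//.
rewrite real_normK ?num_real//.
apply: (@le_trans _ _ (\sum_j (\sum_(t <- s) v t j) ^+ 2)).
  by rewrite (bigD1 j)//= lerDl; apply: sumr_ge0 => i _; exact: sqr_ge0.
apply: le_trans sC _.
have -> : (e * n%:R) ^+ 2 = n%:R * (n%:R * e ^+ 2) by ring.
by rewrite ler_wpM2l.
Qed.

Section coupling.
Variables (R : realType) (X : topologicalType).
Hypothesis pcX : pseudocompact R X.

Let K := beta R X.

Lemma beta_bounded_fun (g : K -> R) : continuous g -> bounded_fun g.
Proof. exact: (compact_bounded_fun (@beta_compact R X)). Qed.

(** Density of [X] in [beta X] approximates the values at [p] by values at points of [X];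
    pseudocompactness makes them exact. *)
Lemma beta_hit (a : nat -> K -> R) (p : K) : (forall n, continuous (a n)) ->
  exists x, forall n, a n (beta_in R x) = a n p.
Proof.
move=> ca; apply: (@pseudocompact_hit R X (fun n x => a n (beta_in R x))) => //.
  move=> n x; apply: (@continuous_comp _ _ _ (@beta_in R X) (a n)); last exact: ca.
  exact: beta_in_continuous.
move=> N e e0.
pose O := [set q : K | forall n, n \in iota 0 N -> `|a n q - a n p| < e].
have nO : nbhs p O.
  apply: filter_all_in => n _; have /continuous_distP := ca n; exact.
have [|q [/interior_subset Oq [x _ xq]]] := @beta_in_dense R X O^° _ (open_interior O).
  by exists p; exact: nbhs_singleton (nbhs_interior nO).
by exists x => n nN; rewrite xq ltW//; apply: Oq; rewrite mem_iota.
Qed.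

Lemma rp_int_sum (mu : radon_prob R K) (I : Type) (r : seq I) (c : I -> R)
    (g : I -> K -> R) : (forall i, continuous (g i)) ->
  rp_int (fun p => \sum_(i <- r) c i * g i p) mu =
  \sum_(i <- r) c i * rp_int (g i) mu.
Proof.
move=> cg; have cM i : continuous (fun p => c i * g i p) by exact: continuous_scale.
elim: r => [|i r IH].
  by rewrite big_nil; under eq_fun do rewrite big_nil; exact: rp_int_cst.
rewrite big_cons; under eq_fun do rewrite big_cons.
rewrite rp_intD//; [|exact: beta_bounded_fun|exact: continuous_sum|]; last first.
  by apply: beta_bounded_fun; exact: continuous_sum.
by rewrite rp_intZ// ?IH//; exact: beta_bounded_fun.
Qed.

Section agreement.
Variables (a : nat -> K -> R) (l : nat -> K -> R).
Hypotheses (ca : forall n, continuous (a n)) (cl : forall n, continuous (l n)).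
Hypothesis lattl : forall i j,
  (exists n, l n = l i \max l j) /\ (exists n, l n = l i \min l j).
Hypothesis sepl : forall p p' u v, u < v \/ (exists n, a n p <> a n p') ->
  exists n, u < l n p /\ l n p' < v.

Definition same_fibre (t : X * X) :=
  forall n, a n (beta_in R t.1) = a n (beta_in R t.2).

(* Otherwise [g p + g' p' < s] for [p], [p'] in the same fibre, so some [l n] lies
   between [g] and [s - g'] up to 1/2, which bounds the sum of the integrals. *)
Lemma fibre_direction (y y' : radon_prob R K) (g g' : K -> R) :
  (forall n, rp_int (l n) y = rp_int (l n) y') -> continuous g -> continuous g' ->
  exists2 t, same_fibre t &
    rp_int g y + rp_int g' y' - 1 <= g (beta_in R t.1) + g' (beta_in R t.2).
Proof.
move=> yy' cg cg'; apply: contrapT => H.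
pose s := rp_int g y + rp_int g' y' - 1.
have Hs t : same_fibre t -> g (beta_in R t.1) + g' (beta_in R t.2) < s.
  by move=> ft; rewrite ltNge; apply/negP => ts; apply: H; exists t.
(* The inequality passes from [X] to [beta X]: [beta_hit] replaces [p] and [p'] by points of [X]
   with the same values under all [a n] and under [g], respectively [g']. *)
have HK p p' : (forall n, a n p = a n p') -> g p + g' p' < s.
  move=> pp'.
  have [x Hx] := @beta_hit (fun n => if n is n'.+1 then a n' else g) p
    ltac:(by case).
  have [x' Hx'] := @beta_hit (fun n => if n is n'.+1 then a n' else g') p'
    ltac:(by case).
  have := Hs (x, x'); rewrite /= (Hx 0%N) (Hx' 0%N); apply.
  by move=> n; rewrite /= (Hx n.+1) (Hx' n.+1).
have cv : continuous (fun p => s + 1 / 2 - g' p).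
  by apply: continuousB => //; exact: continuous_cst.
have [p0] := rp_inh y.
have [_ [n _ <-] Hn] : exists2 f, range l f &
    forall p, g p < f p /\ f p < s + 1 / 2 - g' p.
  apply: (lattice_insertion p0 (@beta_compact R X)) => //.
  - by move=> _ [n _ <-]; exact: cl.
  - by move=> _ _ [i _ <-] [j _ <-]; have [[n <-] _] := lattl i j; exists n.
  - by move=> _ _ [i _ <-] [j _ <-]; have [_ [n <-]] := lattl i j; exists n.
  move=> p p'; have [|n Hn] := @sepl p p' (g p) (s + 1 / 2 - g' p').
    have [|/existsNP] := pselect (forall n, a n p = a n p'); last by right.
    by move=> /HK ?; left; lra.
  by exists (l n) => //; exists n.
(* As [l n] has the same integral for [y] and [y'], the two bounds give
   [rp_int g y <= s + 1 / 2 - rp_int g' y'], whose right side is [rp_int g y - 1 / 2]. *)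
have h1 : rp_int g y <= rp_int (l n) y.
  by apply: rp_int_le => //; [exact: beta_bounded_fun|exact: beta_bounded_fun|
    move=> p; apply: ltW; have [] := Hn p].
have h2 : rp_int (l n) y' <= rp_int (fun p => s + 1 / 2 - g' p) y'.
  by apply: rp_int_le => //; [exact: beta_bounded_fun|exact: beta_bounded_fun|
    move=> p; apply: ltW; have [] := Hn p].
have cc : continuous (fun _ : K => s + 1 / 2) by exact: continuous_cst.
rewrite rp_intB// ?rp_int_cst in h2; [|exact: beta_bounded_fun|exact: beta_bounded_fun].
by move: h1; rewrite yy' => h1; rewrite /s in h2; lra.
Qed.

(* Two measures agreeing on [l] are limits of averages over pairs of points in
   the same fibres: a substitute for a coupling of [y] and [y']. *)
Lemma fibre_coupling (y y' : radon_prob R K) (g : nat -> K -> R) (N : nat) (e : R) :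
  (forall n, rp_int (l n) y = rp_int (l n) y') -> (forall n, continuous (g n)) ->
  0 < e -> exists ps : seq (X * X),
  [/\ (0 < size ps)%N, forall t, t \in ps -> same_fibre t &
    forall n, (n < N)%N ->
    `|(size ps)%:R^-1 * (\sum_(t <- ps) g n (beta_in R t.1)) - rp_int (g n) y| <= e /\
    `|(size ps)%:R^-1 * (\sum_(t <- ps) g n (beta_in R t.2)) - rp_int (g n) y'| <= e].
Proof.
move=> yy' cg e0.
pose T := {t : X * X | same_fibre t}.
(* The errors of a single pair, for both marginals and each of the first [N] test functions; their
   average has to be made small. *)
pose v (t : T) (j : 'I_N * bool) := if j.2
  then g j.1 (beta_in R (sval t).1) - rp_int (g j.1) y
  else g j.1 (beta_in R (sval t).2) - rp_int (g j.1) y'.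
have [M HM] : exists M, forall t j, `|v t j| <= M.
  have HB n : exists B, 0 < B /\ forall p, `|g n p| <= B.
    by have [B] := bounded_funE (beta_bounded_fun (cg n)); exists B.
  have {HB}[B HB] := choice HB.
  exists (\sum_(n < N) (B n + `|rp_int (g n) y| + `|rp_int (g n) y'|)) => t [n b].
  rewrite (bigD1 n)//=; apply: (@le_trans _ _
    (B n + `|rp_int (g n) y| + `|rp_int (g n) y'|)); last first.
    by rewrite lerDl; apply: sumr_ge0 => i _; rewrite !addr_ge0// ltW//; case: (HB i).
  rewrite /v/=; case: b; rewrite (le_trans (ler_normB _ _))//.
    by rewrite -addrA lerD//; [case: (HB n)|rewrite lerDl].
  rewrite lerD//; apply: (@le_trans _ _ (B n)); first by case: (HB n).
  by rewrite lerDl.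
have [|s [s0 Hs]] := @greedy_balance R T _ v M HM _ e e0.
  move=> c.
  (* For the combinations of test functions with coefficients [c], the loss of 1 in
     [fibre_direction] is the one that [greedy_balance] tolerates. *)
  have [|||t ft Ht] := @fibre_direction y y'
    (fun p => \sum_(n < N) c (n, true) * g n p)
    (fun p => \sum_(n < N) c (n, false) * g n p) => //.
  - by apply: continuous_sum => n; exact: continuous_scale.
  - by apply: continuous_sum => n; exact: continuous_scale.
  exists (exist _ t ft).
  have -> : \sum_j c j * v (exist _ t ft) j =
      \sum_(n < N) \sum_(b : bool) c (n, b) * v (exist _ t ft) (n, b).
    by rewrite pair_bigA; apply: eq_bigr => -[].
  under eq_bigr do rewrite big_bool /v/= !mulrBr.
  rewrite big_split/= !sumrB.
  by move: Ht; rewrite !rp_int_sum//; lra.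
exists (map sval s); rewrite size_map; split=> //.
  move=> t; elim: (s) => //= -[t' ft'] s' IH.
  by rewrite in_cons => /predU1P[->|/IH].
have n0 : 0 < (size s)%:R :> R by rewrite ltr0n.
move=> n nN; rewrite !big_map.
have key (F : T -> R) (c : R) : `|\sum_(t <- s) (F t - c)| <= e * (size s)%:R ->
    `|(size s)%:R^-1 * (\sum_(t <- s) F t) - c| <= e.
  rewrite sumrB big_const_seq count_predT iter_addr_0 -[c *+ _]mulr_natl => H.
  rewrite -(ler_pM2r n0) -[X in _ * X <= _]ger0_norm ?(ltW n0)// -normrM.
  by rewrite mulrBl [X in X - _]mulrC mulVKf ?gt_eqF// [c * _]mulrC.
split; apply: key.
  exact: (Hs (Ordinal nN, true)).
exact: (Hs (Ordinal nN, false)).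
Qed.

End agreement.
End coupling.

(** * Extension to the space of measures *)

Lemma cvg_initial (S : choiceType) (T : topologicalType) (w : S -> T) (U : Type)
    (F : set_system U) (f : U -> initial_topology w) (y : initial_topology w) :
  Filter F -> w (f u) @[u --> F] --> w y -> f u @[u --> F] --> y.
Proof.
move=> FF H A [C [[D oD <-] Dy] sCA].
have HD := H D (open_nbhs_nbhs (conj oD Dy)).
by apply: (@filterS _ F FF _ _ _ HD) => u Du; exact: sCA.
Qed.

Section weak_topology.
Variables (R : realType) (Z : topologicalType).

Lemma radon_prob_cvg (U : Type) (F : set_system U) (f : U -> radon_prob R Z)
    (mu : radon_prob R Z) : Filter F ->
  (forall g, continuous g -> bounded_fun g ->
    rp_int g (f u) @[u --> F] --> rp_int g mu) -> f u @[u --> F] --> mu.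
Proof.
move=> FF H; apply/cvg_sup => g.
have /set_mem[cg bg] := valP g.
exact: (@cvg_initial _ _ (rp_int (set_val g)) U F f mu FF (H _ cg bg)).
Qed.

Lemma rp_int_continuous (g : Z -> R) : continuous g -> bounded_fun g ->
  continuous (rp_int g : radon_prob R Z -> R).
Proof.
move=> cg bg mu; have gP : g \in bcfun R Z by exact/mem_set.
have /cvg_sup/(_ (exist _ g gP)) H : nbhs mu --> mu by exact: cvg_id.
move=> A nA; apply: (H (rp_int g @^-1` A)).
exact: (@initial_continuous _ _ (rp_int g) mu A nA).
Qed.

End weak_topology.

Lemma gap_eq (R : realType) (Z Z' : topologicalType) (g : nat -> Z -> R)
    (g' : nat -> Z' -> R) (l : nat -> R) z z' :
  (forall n, g n z = g' n z') -> gap g l z = gap g' l z'.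
Proof.
move=> gg'; rewrite /gap; congr sup; apply/seteqP.
by split=> _ [n _ <-]; exists n => //; rewrite /gap_term gg'.
Qed.

Section extension.
Variables (R : realType) (X : topologicalType).
Hypotheses (crX : completely_regular_space X) (pcX : pseudocompact R X).
Hypothesis preX : precaliber_omega1 X.
Variables (Y : set (radon_prob R (beta R X))) (x0 : X).
Hypotheses (pcY : pseudocompact R Y) (finY : fin_supp_prob R X `<=` Y).
Variable f : Y -> R.
Hypothesis cf : continuous f.

Let K := beta R X.
Let P := radon_prob R K.

Lemma average_fun_exists : exists avg : seq X -> P, [/\ forall s, Y (avg s),
  forall s s', (0 < size s)%N -> perm_eq s s' -> avg s = avg s' &
  forall s (g : K -> R), (0 < size s)%N -> continuous g ->
    rp_int g (avg s) = (size s)%:R^-1 * \sum_(x <- s) g (beta_in R x)].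
Proof.
have H (s : seq X) : exists mu : P, Y mu /\ ((0 < size s)%N ->
    (forall B : set K, <<s open >> B -> rp_mu mu B =
       (\sum_(x <- s) ((size s)%:R^-1)%:E * ((beta_in R x \in B)%:R)%:E)%E) /\
    (forall g : K -> R, continuous g ->
       rp_int g mu = (size s)%:R^-1 * \sum_(x <- s) g (beta_in R x))).
  (* The empty sequence gets the average over [[:: x0]] as a default value. *)
  have [->|s0] := eqVneq s [::].
    have [mu [Fmu _ _]] := @average_exists R X [:: x0] isT.
    by exists mu; split=> //; exact: finY.
  rewrite -size_eq0 -lt0n in s0.
  have [mu [Fmu muB mug]] := average_exists R s0; exists mu; split; first exact: finY.
  by move=> _; split=> // g cg; apply: mug => //; exact: beta_bounded_fun.
have [avg Havg] := choice H; exists avg; split.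
- by move=> s; have [] := Havg s.
- move=> s s' s0 ss'; apply: radon_prob_ext => B mB.
  have [_ /(_ s0)[-> // _]] := Havg s.
  rewrite (perm_size ss') in s0 *; have [_ /(_ s0)[-> // _]] := Havg s'.
  exact: perm_big.
- by move=> s g s0 cg; have [_ /(_ s0)[_ ->]] := Havg s.
Qed.

(** A total version of [f], applicable to averages without carrying proofs of membership in [Y]. *)
Let fY (mu : P) : R :=
  if pselect (mu \in Y) is left H then f (exist _ mu H) else 0.

Lemma fY_val (y : Y) : fY (set_val y) = f y.
Proof.
rewrite /fY; case: pselect => [H|]; last by move: (valP y).
by congr f; apply: val_inj.
Qed.

Lemma fY_cvg (U : Type) (F : set_system U) (h : U -> P) (y : Y) : Filter F ->
  (forall u, Y (h u)) -> h u @[u --> F] --> set_val y ->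
  fY (h u) @[u --> F] --> f y.
Proof.
move=> FF hY hy; pose h' u : Y := exist _ (h u) (mem_set (hY u)).
have -> : (fun u => fY (h u)) = (fun u => f (h' u)).
  by apply/funext => u; rewrite -fY_val.
have h'y : h' u @[u --> F] --> y.
  exact: (@cvg_initial _ _ set_val U F h' y FF hy).
by move=> A nA; exact: (h'y _ (@cf y A nA)).
Qed.

Lemma power_sum_continuous m (g : X -> R) : continuous g ->
  continuous (fun w : power X m => \sum_(x <- power_seq w) g x).
Proof.
move=> cg; pose S k (w : power X k) := \sum_(x <- power_seq w) g x.
rewrite -/(S m); elim: m => [|m IH].
  have -> : S 0%N = fun=> 0 by apply/funext => w; rewrite /S /= big_nil.
  exact: continuous_cst.
have -> : S m.+1 = fun p => g p.2 + S m p.1.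
  by apply/funext => p; rewrite /S /= big_cons.
move=> p; apply: cvgD.
  apply: (@continuous_comp _ _ _ (fun p : power X m * X => p.2) g); last exact: cg.
  exact: continuous_snd.
apply: (@continuous_comp _ _ _ (fun p : power X m * X => p.1) (S m)); last exact: IH.
exact: continuous_fst.
Qed.

Lemma size_power_seq m (w : power X m) : size (power_seq w) = m.
Proof. by elim: m w => // m IH w /=; rewrite IH. Qed.

(** On sequences of fixed length, [f] of the average is continuous because averaging is weakly
    continuous, so [determined_seq] applies; the functions found on [X] are bounded by
    pseudocompactness and extend to [beta X]. *)
Lemma average_determined (avg : seq X -> P) : (forall s, Y (avg s)) ->
  (forall s s', (0 < size s)%N -> perm_eq s s' -> avg s = avg s') ->
  (forall s (g : K -> R), (0 < size s)%N -> continuous g ->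
    rp_int g (avg s) = (size s)%:R^-1 * \sum_(x <- s) g (beta_in R x)) ->
  exists a : nat -> K -> R, (forall n, continuous (a n)) /\
    forall ps : seq (X * X), (forall t, t \in ps -> same_fibre a t) ->
      fY (avg (map fst ps)) = fY (avg (map snd ps)).
Proof.
move=> avgY avgperm avgint.
have [|m|A [cA contA HA]] := @determined_seq R X crX pcX preX (fun s => fY (avg s)).
- move=> s s'; case: (posnP (size s)) => [s0 ss'|s0 ss'].
    by have := perm_size ss'; rewrite s0; case: (s) s0 => //; case: (s').
  by rewrite (avgperm s s').
- move=> p; rewrite /continuous_at.
  pose y : Y := exist _ (avg (p.1 :: power_seq p.2)) (mem_set (avgY _)).
  rewrite (_ : fY (avg (p.1 :: power_seq p.2)) = f y); last by rewrite -fY_val.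
  apply: (@fY_cvg _ _ (fun p : X * power X m => avg (p.1 :: power_seq p.2))).
    by move=> q; exact: avgY.
  apply: radon_prob_cvg => g cg _ /=.
  rewrite avgint//= size_power_seq.
  under eq_fun do rewrite avgint//= size_power_seq big_cons.
  rewrite big_cons.
  have cgi : continuous (g \o @beta_in R X).
    move=> x; apply: continuous_comp; [exact: beta_in_continuous|exact: cg].
  have c1 : continuous (fun q : X * power X m => g (beta_in R q.1) +
      \sum_(x <- power_seq q.2) g (beta_in R x)).
    move=> q; apply: cvgD.
      apply: (@continuous_comp _ _ _ (fun p : X * power X m => p.1)
        (g \o @beta_in R X)); last exact: cgi.
      exact: continuous_fst.
    apply: (@continuous_comp _ _ _ (fun p : X * power X m => p.2)
      (fun w => \sum_(x <- power_seq w) g (beta_in R x))); last first.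
      exact: (@power_sum_continuous m (g \o @beta_in R X)).
    exact: continuous_snd.
  exact: (@continuous_scale R _ m.+1%:R^-1 _ c1 p).
(* The zero function is added so that there is something to enumerate. *)
have cA' : countable (\bigcup_(b in [set: bool]) if b then A else [set fun=> 0]).
  apply: bigcup_countable; first exact: countableP.
  by move=> [] _ //; exact: countable1.
have A0 : (\bigcup_(b in [set: bool]) if b then A else [set fun=> 0]) (fun=> 0).
  by exists false.
have [aX aXE] := countable_enum cA' A0.
have caX n : continuous (aX n).
  have : range aX (aX n) by exists n.
  by rewrite aXE => -[[] _ /= ]; [exact: contA|move=> ->; exact: continuous_cst].
have ext n : exists g : K -> R, continuous g /\ forall x, g (beta_in R x) = aX n x.
  by have [g cg gE] := beta_extension (caX n) (pcX (@caX n)); exists g.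
have [a Ha] := choice ext; exists a; split; first by move=> n; exact: (Ha n).1.
move=> ps psa; apply: HA => t /psa ft b Ab.
have [n _ <-] : range aX b by rewrite aXE; exists true.
by rewrite -!(Ha n).2; exact: ft.
Qed.

Lemma pseudocompact_extension :
  exists2 g : P -> R, continuous g & forall y : Y, g (set_val y) = f y.
Proof.
have [avg [avgY avgperm avgint]] := average_fun_exists.
have [a [ca Ha]] := average_determined avgY avgperm avgint.
have cra : countable (range a).
  by apply: sub_countable (card_image_le _ _) _; exact: countableP.
have [|l [cl lattl sepl']] := countable_lattice cra.
  by move=> _ [n _ <-].
have sepl p p' u v : u < v \/ (exists n, a n p <> a n p') ->
    exists n, u < l n p /\ l n p' < v.
  by move=> [uv|[n an]]; apply: sepl'; [left|right; exists (a n) => //; exists n].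
have coupling := fibre_coupling pcX ca cl lattl sepl.
(* Both values are limits of [fY] at averages over pairs in the same fibres, and the two averages
   have equal values by the choice of [a]. *)
have determined (y y' : Y) : (forall n, rp_int (l n) (set_val y) =
    rp_int (l n) (set_val y')) -> f y = f y'.
  move=> yy'.
  (* Indices of weak neighbourhoods of [y] and [y'] at once: a sequence of test functions, the
     number of them in use, and a tolerance. *)
  pose D : set ((nat -> K -> R) * nat * R) :=
    [set i | (forall n, continuous (i.1.1 n)) /\ 0 < i.2].
  pose B (i : (nat -> K -> R) * nat * R) : set (seq (X * X)) :=
    [set ps | [/\ (0 < size ps)%N, forall t, t \in ps -> same_fibre a t &
      forall n, (n < i.1.2)%N ->
      `|rp_int (i.1.1 n) (avg (map fst ps)) - rp_int (i.1.1 n) (set_val y)| <= i.2 /\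
      `|rp_int (i.1.1 n) (avg (map snd ps)) - rp_int (i.1.1 n) (set_val y')| <= i.2]].
  have Bne i : D i -> B i !=set0.
    move=> [ci i0]; have [ps [ps0 psf Hps]] := coupling _ _ i.1.1 i.1.2 _ yy' ci i0.
    exists ps; split=> // n ni; rewrite !avgint ?size_map// !big_map.
    exact: Hps.
  have FF : ProperFilter (filter_from D B).
    apply: filter_from_proper => //; apply: filter_from_filter.
      by exists ((fun _ _ => 0), 0%N, 1); split=> // n; exact: continuous_cst.
    move=> [[g N] e] [[g' N'] e'] [/= cg e0] [/= cg' e'0].
    (* Two requirements combine by concatenating the first [N] functions of [g] with those of
       [g']. *)
    exists (fun n => if (n < N)%N then g n else g' (n - N)%N, (N + N')%N, Num.min e e').
      split=> /= [n|]; first by case: ifP.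
      by rewrite lt_min e0.
    move=> ps [ps0 psf Hps]; split; split=> // n /= nN.
      have /= := Hps n; rewrite nN => /(_ (ltn_addr _ nN)); rewrite !le_min.
      by move=> [/andP[-> _] /andP[-> _]].
    have /= := Hps (N + n)%N; rewrite ltn_add2l => /(_ nN).
    rewrite ltnNge leq_addr/= addKn !le_min.
    by move=> [/andP[_ ->] /andP[_ ->]].
  have lim (h : seq (X * X) -> seq X) (z : Y) : (forall g N e, B (g, N, e) `<=` [set ps |
      forall n, (n < N)%N -> `|rp_int (g n) (avg (h ps)) - rp_int (g n) (set_val z)| <= e]) ->
      fY (avg (h ps)) @[ps --> filter_from D B] --> f z.
    move=> HB; apply: fY_cvg; first by move=> ps; exact: avgY.
    apply: radon_prob_cvg => g cg _; apply/cvgrPdist_lt => e e0.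
    have e20 : 0 < e / 2 by rewrite divr_gt0.
    exists ((fun=> g), 1%N, e / 2); first by split.
    move=> ps /HB/(_ 0%N isT) /= H; rewrite distrC; apply: le_lt_trans H _; lra.
  have l1 := lim (map fst) y (fun g N e ps H n nN => (let: And3 _ _ H3 := H in H3 n nN).1).
  have l2 := lim (map snd) y' (fun g N e ps H n nN => (let: And3 _ _ H3 := H in H3 n nN).2).
  apply: (cvg_unique (@Rhausdorff R) l1); apply: cvg_trans l2; apply: near_eq_cvg.
  exists ((fun _ _ => 0), 0%N, 1); first by split=> // n; exact: continuous_cst.
  by move=> ps [_ psf _] /=; rewrite (Ha ps psf).
have cY n : continuous (fun y : Y => rp_int (l n) (set_val y)).
  move=> y; apply: (@continuous_comp _ _ _ (set_val : Y -> P) (rp_int (l n))).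
    exact: initial_continuous.
  by apply: rp_int_continuous => //; exact: beta_bounded_fun.
(* Coupling [mu] with itself approximates its integrals by those of averages, which lie in [Y];
   pseudocompactness of [Y] then attains them exactly. *)
have hit (mu : P) : exists y : Y, forall n, rp_int (l n) (set_val y) = rp_int (l n) mu.
  apply: (pseudocompact_hit pcY cY) => N e e0.
  have [ps [ps0 _ Hps]] := coupling mu mu l N e (fun=> erefl) cl e0.
  exists (exist _ (avg (map fst ps)) (mem_set (avgY _))) => n nN.
  have [+ _] := Hps n nN.
  by rewrite [set_val _]/= avgint ?size_map// big_map.
have [sel Hsel] := choice hit; exists (fun mu => f (sel mu)); last first.
  by move=> y; apply: determined => n; exact: Hsel.
apply/continuous_distP => mu0 e e0.
pose L0 n := rp_int (l n) mu0.
pose gY n (y : Y) := rp_int (l n) (set_val y).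
have cgap : continuous (gap gY L0) by exact: gap_continuous.
have cdist : continuous (fun y => e - `|f y - f (sel mu0)|).
  apply: continuousB; first exact: continuous_cst.
  by apply: continuous_norm; apply: continuousB => //; exact: continuous_cst.
(* Where the gap vanishes, [f y = f (sel mu0)], so the maximum is positive. Where the gap is below
   the lower bound [c], the distance of [f y] to [f (sel mu0)] is at most [e - c]. *)
have [|y|c c0 Hc] := @pseudocompact_lbound R Y
    (fun y => Num.max (gap gY L0 y) (e - `|f y - f (sel mu0)|)) pcY.
- by move=> y; apply: continuous_max; [exact: cgap|exact: cdist].
- rewrite lt_max lt_neqAle gap_ge0 andbT eq_sym.
  have [/gap_eq0 gy/=|//] := eqVneq (gap gY L0 y) 0.
  rewrite (determined y (sel mu0)) ?subrr ?normr0 ?subr0// => n.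
  by rewrite Hsel; exact: gy.
have cgapP : continuous (gap (fun n => rp_int (l n)) L0 : P -> R).
  by apply: gap_continuous => n; apply: rp_int_continuous => //; exact: beta_bounded_fun.
have gap0 : gap (fun n => rp_int (l n)) L0 mu0 <= 0.
  by apply: gap_le => n; rewrite /gap_term subrr normr0 ge_min lexx orbT.
have : nbhs mu0 [set mu | gap (fun n => rp_int (l n)) L0 mu < c].
  apply: (cgapP mu0 [set r | r < c]); apply: open_nbhs_nbhs; split; first exact: open_lt.
  exact: le_lt_trans gap0 c0.
apply: filterS => mu /= Hmu.
have gapE : gap gY L0 (sel mu) = gap (fun n => rp_int (l n)) L0 mu.
  by apply: gap_eq => n; exact: Hsel.
by have := Hc (sel mu); rewrite le_max gapE leNgt Hmu/= => ?; lra.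
Qed.

End extension.

Unset Implicit Arguments.

Theorem theorem1p11 (R : realType) (X : topologicalType)
    (tychX : tychonoff_space X) (pcX : pseudocompact R X)
    (preX : precaliber_omega1 X)
    (Y : set (radon_prob R (beta R X))) (pcY : pseudocompact R Y)
    (finY : fin_supp_prob R X `<=` Y) :
  cstar_embedded R Y.
Proof.
move=> f cf _; have [[x0 _]|nX] := pselect (exists x : X, True).
  exact: (pseudocompact_extension tychX.2 pcX preX x0 pcY finY cf).
(* If [X] is empty, so is [beta X] by density; it then carries no probability measure, and [Y] is
   empty. *)
exists (fun=> 0) => [|y]; first exact: continuous_cst.
have [p] := rp_inh (set_val y).
have [|_ [_ [x _ _]]] := @beta_in_dense R X setT _ openT; first by exists p.
by exfalso; apply: nX; exists x.
Qed.
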